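(* Let $A$ be a set of generators of a free subgroup of $\operatorname{SL}_2(\mathbb{Z})$. Then there is a constant $C_A$, depending only on $A$, such that for every prime $p$ for which the reduction $\bar A\subset\operatorname{SL}_2(\mathbb{Z}/p\mathbb{Z})$ of $A$ modulo $p$ generates $\operatorname{SL}_2(\mathbb{Z}/p\mathbb{Z})$, the diameter of the Cayley graph $\Gamma(\operatorname{SL}_2(\mathbb{Z}/p\mathbb{Z}),\bar A)$ is at most $C_A\log p$.
   Context: For a finite group $G$ and a set $S$ of generators of $G$, the Cayley graph $\Gamma(G,S)$ is the (undirected) graph with vertex set $G$ and edge set $\{(sg,g): g\in G, s\in S\}$; its diameter is the least $\ell$ such that every element of $G$ is a product of at most $\ell$ elements of $S\cup S^{-1}$. *)

(* Defs.v *)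
From HB Require Import structures.
From mathcomp Require Import all_boot all_order all_fingroup all_algebra.
From mathcomp Require Import boolp classical_sets reals exp.

Set Implicit Arguments.
Unset Strict Implicit.
Unset Printing Implicit Defensive.

Import GRing.Theory.

Section SpecialLinear.
Variable R : comNzRingType.
Local Open Scope ring_scope.

Record SL2 : predArgType := MkSL2 { SL2val :> 'M[R]_2; _ : \det SL2val == 1 }.

HB.instance Definition _ := [isSub for SL2val].
HB.instance Definition _ := [Choice of SL2 by <:].

Implicit Types x y z : SL2.

Lemma SL2_det x : \det x = 1.
Proof. exact/eqP/(valP x). Qed.

Lemma SL2_mul_subproof x y : \det (val x *m val y) == 1.
Proof. by rewrite det_mulmx !SL2_det mulr1. Qed.

Lemma SL2_one_subproof : \det (1%:M : 'M[R]_2) == 1.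
Proof. by rewrite det1. Qed.

Lemma SL2_adjV x : \adj (val x) *m val x = 1%:M.
Proof. by rewrite mul_adj_mx SL2_det. Qed.

(* For a matrix of determinant 1 the adjugate is the inverse, over any
   commutative ring. *)
Lemma SL2_inv_subproof x : \det (\adj (val x)) == 1.
Proof.
by have := congr1 determinant (SL2_adjV x); rewrite det_mulmx SL2_det mulr1 det1 => ->.
Qed.

Definition SL2_mul x y := MkSL2 (SL2_mul_subproof x y).
Definition SL2_one := MkSL2 SL2_one_subproof.
Definition SL2_inv x := MkSL2 (SL2_inv_subproof x).

Lemma SL2_mulA : associative SL2_mul.
Proof. by move=> x y z; apply: val_inj; rewrite /= mulmxA. Qed.

Lemma SL2_mul1 : left_id SL2_one SL2_mul.
Proof. by move=> x; apply: val_inj; rewrite /= mul1mx. Qed.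

Lemma SL2_mulr1 : right_id SL2_one SL2_mul.
Proof. by move=> x; apply: val_inj; rewrite /= mulmx1. Qed.

Lemma SL2_mulV : left_inverse SL2_one SL2_inv SL2_mul.
Proof. by move=> x; apply: val_inj; rewrite /= SL2_adjV. Qed.

Lemma SL2_mulrV : right_inverse SL2_one SL2_inv SL2_mul.
Proof. by move=> x; apply: val_inj; rewrite /= mul_mx_adj SL2_det. Qed.

HB.instance Definition _ := isGroup.Build SL2
  SL2_mulA SL2_mul1 SL2_mulr1 SL2_mulV SL2_mulrV.

End SpecialLinear.

HB.instance Definition _ (R : countComNzRingType) := [Countable of SL2 R by <:].
HB.instance Definition _ (R : finComNzRingType) := [Finite of SL2 R by <:].

Section FreeGroups.
Variable G : groupType.
Local Open Scope group_scope.
Implicit Types (H A X : set G) (w : seq (G * bool)).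

Definition is_subgroup H :=
  [/\ H 1, forall x y, H x -> H y -> H (x * y) & forall x, H x -> H x^-1].

Definition subgroup_generated A : set G := smallest is_subgroup A.

(* The letter (x, false) stands for x and (x, true) for its inverse. *)
Definition letter_val (l : G * bool) : G := if l.2 then l.1^-1 else l.1.

Definition word_val w : G := \prod_(l <- w) letter_val l.

Definition word_over X w := forall l, l \in w -> X l.1.

Definition reduced w :=
  sorted (fun l m : G * bool => ~~ ((l.1 == m.1) && (l.2 != m.2))) w.

(* H is free on X: each element of H is the value of exactly one reduced word
   in the letters X and their inverses. *)
Definition is_free_basis X H :=
  (forall x, X x -> H x) /\
  forall h, H h -> exists! w, [/\ word_over X w, reduced w & word_val w = h].

Definition is_free_subgroup H :=
  is_subgroup H /\ exists X, is_free_basis X H.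

End FreeGroups.

Section CayleyDiameter.
Variable G : finGroupType.
Local Open Scope group_scope.
Implicit Types S : {set G}.

(* The elements of G at distance at most l from 1 in the Cayley graph; here
   the power is the setwise one. *)
Definition cayley_ball S (l : nat) : {set G} :=
  \bigcup_(k < l.+1) (S :|: S^-1) ^+ k.

Lemma cayley_ball_exhausts S :
  <<S>> = [set: G] -> exists l, cayley_ball S l == [set: G].
Proof.
have [n ->] := gen_expgs S => defG; exists n.
rewrite finset.eqEsubset finset.subsetT -defG /= {defG}.
elim: n => [|n IHn]; first by rewrite /cayley_ball big_ord1 subxx.
apply/fintype.subsetP => z; rewrite expgSr => /mulsgP[x y Bx].
have /finset.bigcupP[k _ Sx] := fintype.subsetP IHn x Bx.
case/setU1P=> [-> | Sy] ->; apply/finset.bigcupP.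
  by exists (widen_ord (leqnSn _) k); rewrite ?mulg1.
by exists (lift ord0 k); rewrite // lift0 expgSr mem_mulg // inE Sy.
Qed.

Definition cayley_diameter S (genS : <<S>> = [set: G]) : nat :=
  ex_minn (cayley_ball_exhausts genS).

End CayleyDiameter.

Section Reduction.
Variables (R T : comNzRingType) (f : {rmorphism R -> T}).

Lemma SL2_map_subproof (x : SL2 R) : (\det (map_mx f x) == 1)%R.
Proof. by rewrite det_map_mx SL2_det rmorph1. Qed.

Definition SL2_map (x : SL2 R) : SL2 T := MkSL2 (SL2_map_subproof x).

End Reduction.

(* 'F_p is Z/pZ only when p is prime. *)
Definition reduce_mod (p : nat) : SL2 int -> SL2 'F_p := SL2_map intr.

Definition reduction_set (p : nat) (A : set (SL2 int)) : {set SL2 'F_p} :=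
  [set g | `[< exists2 a, A a & g = reduce_mod p a >]]%SET.

(* Main.v *)
Require Import Defs.
From HB Require Import structures.
From mathcomp Require Import all_boot all_order all_fingroup all_algebra.
From mathcomp Require Import ring zify.

(* A free group containing two noncommuting elements of [A] contains a free semigroup of rank 2
   generated by two positive words in them. Since the entries of a product of [n] matrices grow at
   most exponentially in [n], that semigroup stays free modulo [p] up to length of order [log p],
   so that a ball of radius [O(log p)] in the Cayley graph has at least [p ^ delta] elements. By
   Helfgott's theorem a bounded power of this ball is the whole group.

   Helfgott's theorem: let [A] be a symmetric generating set containing 1, and suppose that a
   large power [A ^ m] is not much larger than [A]. Escape from subvarieties gives a dimension
   bound |A^j meet (tr = t)| << |A^m|^(2/3) for t^2 <> 4, hence, by orbit-stabilizer, every
   centralizer of a regular semisimple element which meets [A ^ 2] noncentrally does so in at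
   least about |A|^(1/3) elements. If this property were lost when conjugating by some generator,
   then [A] times the intersection would be too large; so it holds for all conjugate tori, and
   counting over them shows that [A] has more than 4^(1/3) q^(8/3) elements. For such a set
   pigeonhole gives many upper unipotent and many upper triangular elements in [A ^ 2], and an
   additive energy estimate shows that [A ^ 16] contains all upper unipotent elements. *)

Set Implicit Arguments.
Unset Strict Implicit.
Unset Printing Implicit Defensive.
Import Order.TTheory GRing.Theory Num.Theory.

(** * Entries of 2x2 matrices *)

Section LinearCombinations.
Variable R : comNzRingType.
Local Open Scope ring_scope.
Implicit Types x y l r c : R.

(** Hypotheses enter only through explicit coefficients, which leaves a polynomial identity for
    [ring]. *)
Lemma lincomb1 c l r x y : l = r -> x - y = c * (l - r) -> x = y.
Proof. by move=> -> /eqP; rewrite subrr mulr0 subr_eq0 => /eqP. Qed.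

Lemma lincomb2 c1 c2 l1 r1 l2 r2 x y : l1 = r1 -> l2 = r2 ->
  x - y = c1 * (l1 - r1) + c2 * (l2 - r2) -> x = y.
Proof. by move=> -> -> /eqP; rewrite !subrr !mulr0 addr0 subr_eq0 => /eqP. Qed.

End LinearCombinations.

Section Entries.
Variable R : comNzRingType.
Local Open Scope ring_scope.
Implicit Types x y : SL2 R.

Definition ea x := val x 0 0.
Definition eb x := val x 0 1.
Definition ec x := val x 1 0.
Definition ed x := val x 1 1.
Definition tr x := ea x + ed x.

Lemma SL2_eq x y : ea x = ea y -> eb x = eb y -> ec x = ec y -> ed x = ed y -> x = y.
Proof.
move=> e1 e2 e3 e4; apply: val_inj; apply/matrixP => i j.
have I2 (k : 'I_2) : k = 0 \/ k = 1.
  by case: k => [[|[|//]]] ?; [left|right]; apply: val_inj.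
by case: (I2 i) => ->; case: (I2 j) => ->.
Qed.

Lemma det2 x : ea x * ed x - eb x * ec x = 1.
Proof.
rewrite -(SL2_det x) (expand_det_row _ 0) !big_ord_recl big_ord0 addr0.
rewrite /cofactor !det_mx11 !mxE /= expr0 expr1 mul1r mulN1r mulrN.
rewrite /ea /eb /ec /ed.
by congr (val x _ _ * val x _ _ - val x _ _ * val x _ _); apply: val_inj.
Qed.

Let mulE x y i j : val (x * y)%g i j = val x i 0 * val y 0 j + val x i 1 * val y 1 j.
Proof.
rewrite !mxE !big_ord_recl big_ord0 addr0.
by congr (_ * _ + val x _ _ * val y _ _); apply: val_inj.
Qed.

Lemma eaM x y : ea (x * y)%g = ea x * ea y + eb x * ec y. Proof. exact: mulE. Qed.
Lemma ebM x y : eb (x * y)%g = ea x * eb y + eb x * ed y. Proof. exact: mulE. Qed.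
Lemma ecM x y : ec (x * y)%g = ec x * ea y + ed x * ec y. Proof. exact: mulE. Qed.
Lemma edM x y : ed (x * y)%g = ec x * eb y + ed x * ed y. Proof. exact: mulE. Qed.

Lemma ea1 : ea 1%g = 1. Proof. by rewrite /ea mxE. Qed.
Lemma eb1 : eb 1%g = 0. Proof. by rewrite /eb mxE. Qed.
Lemma ec1 : ec 1%g = 0. Proof. by rewrite /ec mxE. Qed.
Lemma ed1 : ed 1%g = 1. Proof. by rewrite /ed mxE. Qed.

Fact mk_subproof (a b c d : R) : a * d - b * c = 1 ->
  \det (\matrix_(i, j) (if i == 0 then if j == 0 then a else b
                        else if j == 0 then c else d) : 'M_2) == 1.
Proof.
move=> e; rewrite (expand_det_row _ 0) !big_ord_recl big_ord0 addr0.
by rewrite /cofactor !det_mx11 !mxE /= expr0 expr1 mul1r mulN1r mulrN e.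
Qed.
Definition mk a b c d (e : a * d - b * c = 1) : SL2 R := MkSL2 (mk_subproof e).

Lemma eamk a b c d e : ea (@mk a b c d e) = a. Proof. by rewrite /ea mxE. Qed.
Lemma ebmk a b c d e : eb (@mk a b c d e) = b. Proof. by rewrite /eb mxE. Qed.
Lemma ecmk a b c d e : ec (@mk a b c d e) = c. Proof. by rewrite /ec mxE. Qed.
Lemma edmk a b c d e : ed (@mk a b c d e) = d. Proof. by rewrite /ed mxE. Qed.

Fact inv_subproof x : ed x * ea x - - eb x * - ec x = 1.
Proof. by rewrite -(det2 x); ring. Qed.

Lemma SL2_invE x : x^-1%g = mk (inv_subproof x).
Proof.
apply: (mulgI x); rewrite mulgV.
by apply: SL2_eq; rewrite ?eaM ?ebM ?ecM ?edM ?eamk ?ebmk ?ecmk ?edmk ?ea1 ?eb1 ?ec1 ?ed1;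
  rewrite -?(det2 x); ring.
Qed.

Lemma eaV x : ea x^-1%g = ed x. Proof. by rewrite SL2_invE eamk. Qed.
Lemma ebV x : eb x^-1%g = - eb x. Proof. by rewrite SL2_invE ebmk. Qed.
Lemma ecV x : ec x^-1%g = - ec x. Proof. by rewrite SL2_invE ecmk. Qed.
Lemma edV x : ed x^-1%g = ea x. Proof. by rewrite SL2_invE edmk. Qed.

Definition entE := (eaM, ebM, ecM, edM, eaV, ebV, ecV, edV,
                    (ea1, eb1, ec1, ed1, eamk, ebmk, ecmk, edmk)).

Lemma tr_mulC x y : tr (x * y)%g = tr (y * x)%g.
Proof. by rewrite /tr !entE; ring. Qed.

Lemma trV x : tr x^-1%g = tr x.
Proof. by rewrite /tr !entE addrC. Qed.

Lemma tr_conj x g : tr (g * x * g^-1)%g = tr x.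
Proof. by rewrite tr_mulC mulgA mulVg mul1g. Qed.

End Entries.

Section Commutators.
Variable F : fieldType.
Local Open Scope ring_scope.
Implicit Types x y z g h : SL2 F.

Definition central x := [&& ea x == ed x, eb x == 0 & ec x == 0].

(* The determinant of [h * g - g * h], up to sign. *)
Definition cdet g h :=
  (eb g * ec h - ec g * eb h) ^+ 2 +
  ((ea g - ed g) * eb h - (ea h - ed h) * eb g) *
  (ec g * (ea h - ed h) - ec h * (ea g - ed g)).

(* The differences of the solutions span the line of [g * h - h * g], on which the
   determinant restricts to a nondegenerate quadratic form. *)
Lemma trace_solutions g h x y z : cdet g h != 0 ->
    tr y = tr x -> tr (y * g)%g = tr (x * g)%g -> tr (y * h)%g = tr (x * h)%g ->
    tr z = tr x -> tr (z * g)%g = tr (x * g)%g -> tr (z * h)%g = tr (x * h)%g ->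
  [\/ x = y, y = z | z = x].
Proof.
move=> nz.
pose wa := eb g * ec h - ec g * eb h.
pose wb := (ea g - ed g) * eb h - (ea h - ed h) * eb g.
pose wc := ec g * (ea h - ed h) - ec h * (ea g - ed g).
pose D := wa ^+ 2 + wb * wc.
have D0 : D != 0 by [].
(* The difference from [x] is traceless and satisfies two further linear equations, whose cross
   product is [(wa, wb, wc)] up to sign. *)
have line (y' : SL2 F) : tr y' = tr x -> tr (y' * g)%g = tr (x * g)%g ->
    tr (y' * h)%g = tr (x * h)%g -> exists s,
      [/\ ea y' = ea x + s * wa, eb y' = eb x + s * wb, ec y' = ec x + s * wc &
          ed y' = ed x - s * wa].
  rewrite /tr !entE => e1 e2 e3.
  pose a := ea y' - ea x; pose b := eb y' - eb x; pose c := ec y' - ec x.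
  have e1' : ed y' = ed x - a.
    by apply: (lincomb1 (c := 1) e1); rewrite /a; ring.
  have E2 : a * (ea g - ed g) + b * ec g + c * eb g = 0.
    by apply: (lincomb2 (c1 := 1) (c2 := - ed g) e2 e1); rewrite /a /b /c; ring.
  have E3 : a * (ea h - ed h) + b * ec h + c * eb h = 0.
    by apply: (lincomb2 (c1 := 1) (c2 := - ed h) e3 e1); rewrite /a /b /c; ring.
  have P1 : a * wb = b * wa.
    by apply: (lincomb2 (c1 := eb h) (c2 := - eb g) E2 E3); rewrite /wa /wb; ring.
  have P2 : a * wc = c * wa.
    by apply: (lincomb2 (c1 := - ec h) (c2 := ec g) E2 E3); rewrite /wa /wc; ring.
  have P3 : b * wc = c * wb.
    by apply: (lincomb2 (c1 := ea h - ed h) (c2 := - (ea g - ed g)) E2 E3);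
      rewrite /wb /wc; ring.
  have solve u k : (a * wa + b * wc) * k = u * D -> u = (a * wa + b * wc) / D * k.
    by move=> e; apply: (mulIf D0); rewrite -e [RHS]mulrAC divfK.
  exists ((a * wa + b * wc) / D); rewrite e1'.
  have <- : a = (a * wa + b * wc) / D * wa.
    by apply: solve; apply: (lincomb1 (c := - wc) P1); rewrite /D; ring.
  have <- : b = (a * wa + b * wc) / D * wb.
    by apply: solve; apply: (lincomb1 (c := wa) P1); rewrite /D; ring.
  have <- : c = (a * wa + b * wc) / D * wc.
    by apply: solve; apply: (lincomb2 (c1 := wa) (c2 := wc) P2 P3); rewrite /D; ring.
  by split; rewrite /a /b /c; ring.
move=> y1 y2 y3 z1 z2 z3.
have [s [ya yb yc yd]] := line y y1 y2 y3.
have [r [za zb zc zd]] := line z z1 z2 z3.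
(* On this line determinant 1 reads [s * (k - s * D) = 0], so besides [x] itself at most one
   solution remains. *)
pose k := wa * (ed x - ea x) - wb * ec x - wc * eb x.
have quad (y' : SL2 F) s' : ea y' = ea x + s' * wa -> eb y' = eb x + s' * wb ->
    ec y' = ec x + s' * wc -> ed y' = ed x - s' * wa -> s' * (k - s' * D) = 0.
  move=> h1 h2 h3 h4; have := det2 y'; rewrite h1 h2 h3 h4 => e.
  by apply: (lincomb2 (c1 := 1) (c2 := -1) e (det2 x)); rewrite /k /D; ring.
have eq_s (y' z' : SL2 F) s' : ea y' = ea x + s' * wa -> eb y' = eb x + s' * wb ->
    ec y' = ec x + s' * wc -> ed y' = ed x - s' * wa ->
    ea z' = ea x + s' * wa -> eb z' = eb x + s' * wb -> ec z' = ec x + s' * wc ->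
    ed z' = ed x - s' * wa -> y' = z'.
  by move=> h1 h2 h3 h4 i1 i2 i3 i4; apply: SL2_eq; rewrite ?h1 ?h2 ?h3 ?h4.
have [s0|s0] := eqVneq s 0.
  by apply: Or31; apply/esym/(eq_s _ _ s) => //; rewrite s0; ring.
have [r0|r0] := eqVneq r 0.
  by apply: Or33; apply/(eq_s _ _ r) => //; rewrite r0; ring.
have /eqP := quad _ _ ya yb yc yd; rewrite mulf_eq0 (negPf s0) subr_eq0 /= => /eqP ks.
have /eqP := quad _ _ za zb zc zd; rewrite mulf_eq0 (negPf r0) subr_eq0 /= ks => /eqP/(mulIf D0) sr.
by apply: Or32; apply: (eq_s _ _ s) => //; rewrite sr.
Qed.

(* Two elements commute when the vectors [(ea - ed, eb, ec)] are parallel. *)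
Lemma commute_cross x y : reflect (x * y = y * x)%g
  [&& eb x * ec y == eb y * ec x, (ea x - ed x) * eb y == (ea y - ed y) * eb x &
      (ea x - ed x) * ec y == (ea y - ed y) * ec x].
Proof.
apply: (iffP and3P) => [[/eqP e1 /eqP e2 /eqP e3]|e].
  apply: SL2_eq; rewrite !entE.
  - by apply: (lincomb1 (c := 1) e1); ring.
  - by apply: (lincomb1 (c := 1) e2); ring.
  - by apply: (lincomb1 (c := -1) e3); ring.
  - by apply: (lincomb1 (c := -1) e1); ring.
have := (congr1 (@ea _) e, congr1 (@eb _) e, congr1 (@ec _) e).
rewrite /= !entE => -[[e1 e2] e3]; split; apply/eqP.
- by apply: (lincomb1 (c := 1) e1); ring.
- by apply: (lincomb1 (c := 1) e2); ring.
- by apply: (lincomb1 (c := -1) e3); ring.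
Qed.

End Commutators.

(** * Centralizers of noncentral elements *)

Section Centralizers.
Variable F : fieldType.
Hypothesis F2 : (2%:R != 0 :> F)%R.
Local Open Scope ring_scope.
Implicit Types x y z g h : SL2 F.

(** Both sides are the discriminant of the characteristic polynomial; the left one is a quadratic
    form in the traceless part. *)
Lemma discE x : (ea x - ed x) ^+ 2 + 4 * (eb x * ec x) = tr x ^+ 2 - 4.
Proof. by apply: (lincomb1 (c := -4) (det2 x)); rewrite /tr; ring. Qed.

Lemma central1 x : central x -> [/\ ea x ^+ 2 = 1, ed x = ea x, eb x = 0 & ec x = 0].
Proof.
case/and3P=> /eqP e1 /eqP e2 /eqP e3; split=> //.
by rewrite -(det2 x) -e1 e2; ring.
Qed.

Lemma central_tr x : central x -> tr x ^+ 2 = 4.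
Proof.
by case/central1=> e1 e2 _ _; rewrite /tr e2; apply: (lincomb1 (c := 4) e1); ring.
Qed.

Lemma central_commute x y : central x -> (x * y = y * x)%g.
Proof.
by case/central1=> _ e1 e2 e3; apply/commute_cross; rewrite e1 e2 e3 subrr !mul0r !mulr0 !eqxx.
Qed.

(** Equivalently, [y - s * x] is a scalar matrix. *)
Definition parallel x y s := [/\ ea y - ed y = s * (ea x - ed x), eb y = s * eb x & ec y = s * ec x].

(** The vectors of [commute_cross] are parallel and that of [x] is nonzero, so the ratio is read off
    at a nonvanishing coordinate. *)
Lemma commute_parallel x y : ~~ central x -> (x * y = y * x)%g -> exists s, parallel x y s.
Proof.
move=> nx /commute_cross/and3P[/eqP e1 /eqP e2 /eqP e3].
have div_eq (u v w d : F) : d != 0 -> u * d = w * v -> u = w / d * v.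
  by move=> d0 e; apply: (mulIf d0); rewrite [RHS]mulrAC divfK.
have [b0|b0] := eqVneq (eb x) 0; last first.
  exists (eb y / eb x); split; apply: div_eq => //.
    by apply: (lincomb1 (c := -1) e2); ring.
  by apply: (lincomb1 (c := 1) e1); ring.
have [c0|c0] := eqVneq (ec x) 0; last first.
  exists (ec y / ec x); split; apply: div_eq => //.
    by apply: (lincomb1 (c := -1) e3); ring.
  by apply: (lincomb1 (c := -1) e1); ring.
have a0 : ea x - ed x != 0.
  by apply: contra nx; rewrite subr_eq0 /central b0 c0 !eqxx !andbT.
exists ((ea y - ed y) / (ea x - ed x)); rewrite /parallel b0 c0 !mulr0 divfK //; split=> //.
  by apply: (mulfI a0); rewrite e2 b0 !mulr0.
by apply: (mulfI a0); rewrite e3 c0 !mulr0.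
Qed.

Lemma parallel_commute x y z s r : parallel x y s -> parallel x z r -> (y * z = z * y)%g.
Proof.
move=> [e1 e2 e3] [f1 f2 f3]; apply/commute_cross; rewrite e1 e2 e3 f1 f2 f3.
by apply/and3P; split; apply/eqP; ring.
Qed.

(** Both [y] and [z] are linear combinations of [x] and the identity. *)
Lemma commute_trans x y z : ~~ central x ->
  (x * y = y * x)%g -> (x * z = z * x)%g -> (y * z = z * y)%g.
Proof.
move=> nx /(commute_parallel nx)[s sP] /(commute_parallel nx)[r rP].
exact: parallel_commute sP rP.
Qed.

Lemma eq_of_tr x y : ea x - ed x = ea y - ed y -> tr x = tr y ->
  eb x = eb y -> ec x = ec y -> x = y.
Proof.
rewrite /tr => e1 e2 e3 e4; apply: SL2_eq => //; apply: (mulfI F2).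
  by apply: (lincomb2 (c1 := 1) (c2 := 1) e1 e2); ring.
by apply: (lincomb2 (c1 := -1) (c2 := 1) e1 e2); ring.
Qed.

Lemma parallel_tr x y s : parallel x y s -> tr y ^+ 2 - 4 = s ^+ 2 * (tr x ^+ 2 - 4).
Proof. by case=> e1 e2 e3; rewrite -!discE e1 e2 e3; ring. Qed.

(** By [parallel_tr], equal traces force the ratios of [y] and [z] to [x] to agree up to sign;
    inversion negates the traceless part. *)
Lemma commute_same_tr x y z : ~~ central x -> (x * y = y * x)%g -> (x * z = z * x)%g ->
  tr y ^+ 2 != 4 -> tr z = tr y -> z = y \/ z = y^-1%g.
Proof.
move=> nx /(commute_parallel nx)[s sP] /(commute_parallel nx)[r rP] ty e.
have := parallel_tr rP; rewrite e (parallel_tr sP).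
have x0 : tr x ^+ 2 - 4 != 0.
  by apply: contraNneq ty => x0; rewrite -subr_eq0 (parallel_tr sP) x0 mulr0.
move/(mulIf x0)/eqP; rewrite eqf_sqr; case: sP => e1 e2 e3; case: rP => f1 f2 f3.
case/orP=> /eqP sr; [left|right].
  by apply: eq_of_tr; rewrite ?e1 ?e2 ?e3 ?f1 ?f2 ?f3 ?sr.
apply: eq_of_tr; rewrite ?trV //; rewrite !entE ?f1 ?f2 ?f3 ?e2 ?e3 ?sr ?mulNr ?opprK //.
by rewrite -[ed y - _]opprB e1 sr; ring.
Qed.

Lemma centralJ x g : central (g * x * g^-1)%g = central x.
Proof.
have aux y h : central y -> central (h * y * h^-1)%g.
  by move=> sy; rewrite -(central_commute _ sy) -mulgA mulgV mulg1.
apply/idP/idP=> [|/aux//] /(aux _ g^-1%g).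
by rewrite invgK !mulgA mulVg mul1g mulgVK.
Qed.

(** A noncentral [y] has a nonzero ratio to [x], so its discriminant vanishes only together with
    that of [x]. *)
Lemma commute_tr x y : ~~ central x -> (x * y = y * x)%g -> tr x ^+ 2 != 4 -> ~~ central y ->
  tr y ^+ 2 != 4.
Proof.
move=> nx /(commute_parallel nx)[s sP] tx; apply: contra => ty.
have := parallel_tr sP; rewrite (eqP ty) subrr => /esym/eqP.
rewrite mulf_eq0 subr_eq0 (negPf tx) orbF sqrf_eq0 => /eqP s0.
by case: sP => /eqP; rewrite s0 !mul0r subr_eq0 /central => -> -> ->; rewrite eqxx.
Qed.

End Centralizers.

Section Elementary.
Variable R : comNzRingType.
Local Open Scope ring_scope.

Fact upper_subproof (s : R) : 1 * 1 - s * 0 = 1. Proof. by ring. Qed.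
Definition upper s : SL2 R := mk (upper_subproof s).
Fact lower_subproof (s : R) : 1 * 1 - 0 * s = 1. Proof. by ring. Qed.
Definition lower s : SL2 R := mk (lower_subproof s).

(* [1 + r E] for the nilpotent [E] with kernel and image spanned by [(1, s)]. *)
Fact transvection_subproof (r s : R) : (1 - r * s) * (1 + r * s) - r * (- (r * s ^+ 2)) = 1.
Proof. by ring. Qed.
Definition transvection r s : SL2 R := mk (transvection_subproof r s).

End Elementary.

(** * Existence of conjugators avoiding degenerate positions *)

Section NonDegeneracy.
Variable F : finFieldType.
Hypothesis F2 : (2%:R != 0 :> F)%R.
Hypothesis F3 : (3%:R != 0 :> F)%R.
Hypothesis F7 : 7 <= #|F|.
Local Open Scope ring_scope.
Implicit Types x y z g h : SL2 F.

(** The sign [e] is 1 or -1, and linear algebra settles each case: -1 would kill [ec y] and the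
    diagonal, against determinant 1. *)
Lemma conj_upper_sign y e : e ^+ 2 = 1 ->
    ea (upper 1 * y * (upper 1)^-1)%g = e * ea y -> eb (upper 1 * y * (upper 1)^-1)%g = e * eb y ->
    ec (upper 1 * y * (upper 1)^-1)%g = e * ec y -> ed (upper 1 * y * (upper 1)^-1)%g = e * ed y ->
  ec y = 0 /\ ea y = ed y.
Proof.
rewrite /upper !entE => e2 h1 h2 h3 h4.
have : (e - 1) * (e + 1) = 0 by apply: (lincomb1 (c := 1) e2); ring.
move/eqP; rewrite mulf_eq0 subr_eq0 addr_eq0 => /orP[/eqP e1|/eqP e1]; rewrite e1 in h1 h2 h3 h4.
  have c0 : ec y = 0 by apply: (lincomb1 (c := 1) h1); ring.
  split=> //; apply: (lincomb2 (c1 := -1) (c2 := -1) h2 c0); ring.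
have c0 : ec y = 0 by apply: (mulfI F2); apply: (lincomb1 (c := 1) h3); ring.
have a0 : ea y = 0 by apply: (mulfI F2); apply: (lincomb2 (c1 := 1) (c2 := -1) h1 c0); ring.
have d0 : ed y = 0 by apply: (mulfI F2); apply: (lincomb2 (c1 := 1) (c2 := 1) h4 c0); ring.
by have /eqP := det2 y; rewrite a0 d0 c0 !mulr0 subrr eq_sym oner_eq0.
Qed.

Lemma conj_lower_sign y e : e ^+ 2 = 1 ->
    ea (lower 1 * y * (lower 1)^-1)%g = e * ea y -> eb (lower 1 * y * (lower 1)^-1)%g = e * eb y ->
    ec (lower 1 * y * (lower 1)^-1)%g = e * ec y -> ed (lower 1 * y * (lower 1)^-1)%g = e * ed y ->
  eb y = 0.
Proof.
rewrite /lower !entE => e2 h1 h2 h3 h4.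
have : (e - 1) * (e + 1) = 0 by apply: (lincomb1 (c := 1) e2); ring.
move/eqP; rewrite mulf_eq0 subr_eq0 addr_eq0 => /orP[/eqP e1|/eqP e1]; rewrite e1 in h1 h2 h3 h4.
  by apply: (lincomb1 (c := -1) h1); ring.
by apply: (mulfI F2); apply: (lincomb1 (c := 1) h2); ring.
Qed.

(** Otherwise every conjugate of [y], including [y] itself, would be [x^-1] up to sign; conjugating
    by [upper 1] and [lower 1] then shows [y] central. *)
Lemma exists_noncentral_conj x y : ~~ central y -> exists g, ~~ central (x * (g * y * g^-1))%g.
Proof.
move=> ny; apply/existsP; apply: contraNT ny => /existsPn sc.
have key g : exists2 e, e ^+ 2 = 1 &
    [/\ ea (g * y * g^-1)%g = e * ea y, eb (g * y * g^-1)%g = e * eb y,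
        ec (g * y * g^-1)%g = e * ec y & ed (g * y * g^-1)%g = e * ed y].
  have aux z : central (x * z)%g -> exists2 e, e ^+ 2 = 1 &
      [/\ ea z = e * ed x, eb z = - e * eb x, ec z = - e * ec x & ed z = e * ea x].
    rewrite -[in X in _ -> X](mulKg x z); move: (x * z)%g => w /central1[e2 e3 e4 e5].
    by exists (ea w) => //; rewrite !entE e3 e4 e5; split; ring.
  have [/= e1 e12 [h1 h2 h3 h4]] := aux _ (negbNE (sc g)).
  have := sc 1%g; rewrite mul1g invg1 mulg1 => /negbNE/aux[/= e2 e22 [i1 i2 i3 i4]].
  exists (e1 * e2); first by rewrite exprMn e12 e22 mulr1.
  rewrite h1 h2 h3 h4 i1 i2 i3 i4.
  by split; [apply: (lincomb1 (c := - e1 * ed x) e22) | apply: (lincomb1 (c := e1 * eb x) e22) |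
    apply: (lincomb1 (c := e1 * ec x) e22) | apply: (lincomb1 (c := - e1 * ea x) e22)]; ring.
have [e1 e12 [h1 h2 h3 h4]] := key (upper 1).
have [e2 e22 [i1 i2 i3 i4]] := key (lower 1).
have [c0 ad] := conj_upper_sign e12 h1 h2 h3 h4.
by rewrite /central c0 ad (conj_lower_sign e22 i1 i2 i3 i4) !eqxx.
Qed.

(** Its roots are the [s] for which [(1, s)] is an eigenvector of [g]. *)
Definition quadp g : {poly F} := Poly [:: - ec g; ea g - ed g; eb g].

Lemma quadp_neq0 g : ~~ central g -> quadp g != 0.
Proof.
apply: contra => /eqP q0.
have e k : [:: - ec g; ea g - ed g; eb g]`_k = 0 by rewrite -coef_Poly -/(quadp g) q0 coef0.
move: (e 0) (e 1) (e 2) => /= /eqP c0 /eqP ad /eqP b0.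
by rewrite /central b0 -subr_eq0 ad -oppr_eq0 c0.
Qed.

Lemma horner_quadp g s : (quadp g).[s] = eb g * s ^+ 2 + (ea g - ed g) * s - ec g.
Proof. by rewrite horner_Poly /=; ring. Qed.

(** The product has degree at most 6, while the field has at least 7 elements. *)
Lemma avoid_roots (p1 p2 p3 : {poly F}) : p1 != 0 -> p2 != 0 -> p3 != 0 ->
  (size p1 <= 3)%N -> (size p2 <= 3)%N -> (size p3 <= 3)%N ->
  exists s, [/\ p1.[s] != 0, p2.[s] != 0 & p3.[s] != 0].
Proof.
move=> n1 n2 n3 s1 s2 s3.
have nz : p1 * p2 * p3 != 0 by rewrite !mulf_neq0.
have : ~~ all (root (p1 * p2 * p3)) (enum F).
  apply/negP => /(max_poly_roots nz)/(_ (enum_uniq _)).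
  rewrite -cardE => lt; have := leq_ltn_trans F7 lt.
  rewrite ltnNge size_mul ?mulf_neq0 // size_mul //.
  move: s1 s2 s3; case: (size p1) => [|[|[|[|?]]]] //; case: (size p2) => [|[|[|[|?]]]] //;
  by case: (size p3) => [|[|[|[|?]]]].
by case/allPn=> s _; rewrite /root !hornerE !mulf_eq0 !negb_or => /andP[/andP[]]; exists s.
Qed.

Definition cdet_entries (a b c d a' b' c' d' : F) :=
  (b * c' - c * b') ^+ 2 + ((a - d) * b' - (a' - d') * b) * (c * (a' - d') - c' * (a - d)).

Lemma cdetE g h : cdet g h = cdet_entries (ea g) (eb g) (ec g) (ed g) (ea h) (eb h) (ec h) (ed h).
Proof. by []. Qed.

(* The fourth difference extracts the leading coefficient of a polynomial of degree 4. *)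
Lemma cdet_leading (a b c d : F) (u v w : F * F * F * F) :
  let f r := cdet_entries a b c d
    (u.1.1.1 + r * v.1.1.1 + r ^+ 2 * w.1.1.1) (u.1.1.2 + r * v.1.1.2 + r ^+ 2 * w.1.1.2)
    (u.1.2 + r * v.1.2 + r ^+ 2 * w.1.2) (u.2 + r * v.2 + r ^+ 2 * w.2) in
  f 2 - 4 * f 1 + 6 * f 0 - 4 * f (-1) + f (-2) =
    24 * cdet_entries a b c d w.1.1.1 w.1.1.2 w.1.2 w.2.
Proof. by rewrite /= /cdet_entries; ring. Qed.

(** Only the coefficient of [r ^+ 2] matters later: a matrix of rank at most one, killing [(1, s)],
    with image spanned by [x (1, s)] when nonzero. *)
Lemma conj_transvection x z s : exists u v : F * F * F * F, forall r,
  let m := ea x + eb x * s in let n := ec x + ed x * s in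
  let k := (quadp z).[s] in
  let y := (x * (transvection r s * z * (transvection r s)^-1))%g in
  [/\ ea y = u.1.1.1 + r * v.1.1.1 + r ^+ 2 * (k * (- s * m)),
      eb y = u.1.1.2 + r * v.1.1.2 + r ^+ 2 * (k * m),
      ec y = u.1.2 + r * v.1.2 + r ^+ 2 * (k * (- s * n)) &
      ed y = u.2 + r * v.2 + r ^+ 2 * (k * n)].
Proof.
pose ca := - s * ea z + ec z + s * ea z + s ^+ 2 * eb z.
pose cb := - s * eb z + ed z - ea z - s * eb z.
pose cc := - s ^+ 2 * ea z + s * ec z + s * ec z + s ^+ 2 * ed z.
pose cd := - s ^+ 2 * eb z + s * ed z - ec z - s * ed z.
exists (ea (x * z)%g, eb (x * z)%g, ec (x * z)%g, ed (x * z)%g).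
exists (ea x * ca + eb x * cc, ea x * cb + eb x * cd,
        ec x * ca + ed x * cc, ec x * cb + ed x * cd) => r.
by rewrite /= horner_quadp /ca /cb /cc /cd /transvection !entE; split; ring.
Qed.

(** The right side is [quadp g], homogenized, at the vector [x (1, s)]. *)
Lemma quadpJ g x s : (quadp (x^-1 * g * x)%g).[s] =
  eb g * (ec x + ed x * s) ^+ 2 + (ea g - ed g) * (ea x + eb x * s) * (ec x + ed x * s)
  - ec g * (ea x + eb x * s) ^+ 2.
Proof. by rewrite horner_quadp !entE; ring. Qed.

(** For [h = transvection r s] the value is a polynomial of degree at most 4 in [r]. Its leading
    coefficient is a product of values at [s] of three quadratics, and [s] is chosen off their
    roots; then one of [r = -2, ..., 2] works. *)
Lemma exists_cdet_conj g x z : ~~ central g -> ~~ central z ->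
  exists h, cdet g (x * (h * z * h^-1))%g != 0.
Proof.
move=> ng nz.
have ngx : ~~ central (x^-1 * g * x)%g by rewrite -{2}[x]invgK centralJ.
have sz k : (size (quadp k) <= 3)%N by apply: size_Poly.
have [s [zs gs gxs]] := avoid_roots (quadp_neq0 nz) (quadp_neq0 ng) (quadp_neq0 ngx)
  (sz _) (sz _) (sz _).
have [u [v uv]] := conj_transvection x z s.
pose h r := transvection r s : SL2 F.
pose f r := cdet g (x * (h r * z * (h r)^-1))%g.
suff lead : f 2 - 4 * f 1 + 6 * f 0 - 4 * f (-1) + f (-2) != 0.
  have [|n2] := eqVneq (f 2) 0; last by exists (h 2).
  have [|n1] := eqVneq (f 1) 0; last by exists (h 1).
  have [|n0] := eqVneq (f 0) 0; last by exists (h 0).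
  have [|m1] := eqVneq (f (-1)) 0; last by exists (h (-1)).
  have [|m2] := eqVneq (f (-2)) 0; last by exists (h (-2)).
  by move=> e1 e2 e3 e4 e5; case/eqP: lead; rewrite e1 e2 e3 e4 e5; ring.
pose m := ea x + eb x * s; pose n := ec x + ed x * s; pose k := (quadp z).[s].
have := cdet_leading (ea g) (eb g) (ec g) (ed g) u v (k * (- s * m), k * m, k * (- s * n), k * n).
rewrite /=.
have fE r : f r = cdet_entries (ea g) (eb g) (ec g) (ed g)
    (u.1.1.1 + r * v.1.1.1 + r ^+ 2 * (k * (- s * m)))
    (u.1.1.2 + r * v.1.1.2 + r ^+ 2 * (k * m))
    (u.1.2 + r * v.1.2 + r ^+ 2 * (k * (- s * n)))
    (u.2 + r * v.2 + r ^+ 2 * (k * n)).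
  by rewrite /f cdetE; have [-> -> -> ->] := uv r.
rewrite -!fE => ->.
have -> : cdet_entries (ea g) (eb g) (ec g) (ed g) (k * (- s * m)) (k * m) (k * (- s * n)) (k * n)
  = k ^+ 2 * ((quadp g).[s] * (quadp (x^-1 * g * x)%g).[s]).
  by rewrite quadpJ -/m -/n horner_quadp /cdet_entries; ring.
(* The characteristic is neither 2 nor 3, so 24 is nonzero. *)
have -> : 24 = 2 * 2 * 2 * 3 :> F by ring.
by rewrite !mulf_neq0 // expf_neq0.
Qed.

End NonDegeneracy.

(** * Escape from subvarieties *)

Section PowersOfSets.
Variable G : finGroupType.
Local Open Scope group_scope.
Implicit Types A B : {set G}.

Lemma expgs_sub A m n : 1 \in A -> m <= n -> A ^+ m \subset A ^+ n.
Proof.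
move=> A1 /subnK <-; elim: (n - m)%N => [|k IHk]; first by rewrite add0n.
by rewrite addSn expgS (subset_trans IHk) // mulg_subr.
Qed.

Lemma expgs1 A n : 1 \in A -> 1 \in A ^+ n.
Proof. by move=> A1; apply: (subsetP (expgs_sub A1 (leq0n n))); rewrite expg0 inE. Qed.

Lemma expgsD_mem A m n x y : x \in A ^+ m -> y \in A ^+ n -> x * y \in A ^+ (m + n).
Proof. by move=> xA yA; rewrite expgD mem_mulg. Qed.

Lemma expgsV_mem A n x : A^-1 = A -> x \in A ^+ n -> x^-1 \in A ^+ n.
Proof.
move=> AV; elim: n x => [|n IHn] x; first by rewrite !expg0 !inE eq_invg1.
rewrite {1}expgS => /mulsgP[y z yA zA ->]; rewrite invMg -[n.+1]addn1 expgsD_mem ?IHn //.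
by rewrite -AV inE invgK.
Qed.

(** In a finite group the generated subgroup is a power of [1 |: A], so inverses of generators need
    not be considered. *)
Lemma gen_ind A (P : G -> Prop) : <<A>> = [set: G] ->
  P 1 -> (forall a g, a \in A -> P g -> P (a * g)) -> forall g, P g.
Proof.
move=> genA P1 PA g; have : g \in <<A>> by rewrite genA inE.
have [n ->] := gen_expgs A; elim: n g => [|n IHn] g; first by rewrite expg0 inE => /eqP->.
rewrite expgS => /mulsgP[a y /setU1P[-> | aA] /IHn Py ->]; first by rewrite mul1g.
exact: PA.
Qed.

End PowersOfSets.

Section Escape.
Variables (F : fieldType) (G : finGroupType).
Local Open Scope ring_scope.

Definition equivariant n (phi : G -> 'rV[F]_n) :=
  forall a, exists M : 'M_n, forall g, phi (a * g)%g = phi g *m M.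

Definition linear_in n (phi : G -> 'rV[F]_n) (f : G -> F) :=
  exists c : 'cV_n, forall g, f g = (phi g *m c) 0 0.

(* As long as the span of [phi @: H] is not stable, one more element increases its
   dimension, which cannot exceed [n]. *)
Lemma escape n (phi : G -> 'rV[F]_n) (A : {set G}) : equivariant phi ->
    1%g \in A -> <<A>>%g = [set: G] ->
  exists H : {set G}, [/\ H \subset (A ^+ n)%g, (#|H| <= n)%N &
    forall f, linear_in phi f -> {in H, forall h, f h = 0} -> forall g, f g = 0].
Proof.
move=> eq_phi A1 genA.
pose W (H : {set G}) := (\sum_(h in H) <<phi h>>)%MS.
pose stable (H : {set G}) := forall g, (phi g <= W H)%MS.
have step k : exists H : {set G}, [/\ H \subset (A ^+ k)%g, (#|H| <= k)%N &
    stable H \/ (k <= \rank (W H))%N].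
  elim: k => [|k [H [HA cH [sH|dH]]]].
  - by exists finset.set0; rewrite sub0set cards0; split=> //; right.
  - exists H; split; [|exact: leqW|by left].
    exact: subset_trans HA (expgs_sub A1 (leqnSn k)).
  have add x : x \in (A ^+ k.+1)%g -> ~~ (phi x <= W H)%MS -> exists H' : {set G},
      [/\ H' \subset (A ^+ k.+1)%g, (#|H'| <= k.+1)%N & stable H' \/ (k.+1 <= \rank (W H'))%N].
    move=> xA nx; exists (x |: H); split.
    - by rewrite subUset sub1set xA (subset_trans HA (expgs_sub A1 (leqnSn k))).
    - by rewrite cardsU1 -add1n leq_add // leq_b1.
    right; apply: leq_ltn_trans dH _; apply: rank_ltmx; rewrite ltmxE.
    have WH : (W H <= W (x |: H))%MS.
      by apply/sumsmx_subP => h hH; apply: (sumsmx_sup h); rewrite ?inE ?hH ?orbT.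
    rewrite WH /=; apply: contra nx => le; apply: submx_trans le.
    by apply: (sumsmx_sup x); rewrite ?inE ?eqxx // genmxE.
  have [phi1|] := boolP (phi 1%g <= W H)%MS; last by apply: add; apply: expgs1.
  have [/forall_inP st|] := boolP [forall a in A, [forall h in H, (phi (a * h)%g <= W H)%MS]].
    exists H; split; [exact: subset_trans HA (expgs_sub A1 (leqnSn k))|exact: leqW|left].
    (* A span containing [phi 1] and stable under the generators contains every [phi g]. *)
    apply: (gen_ind genA) => // a g aA phig; have [M phiM] := eq_phi a.
    rewrite phiM; apply: submx_trans (submxMr M phig) _.
    rewrite sumsmxMr; apply/sumsmx_subP => h hH.
    by rewrite (eqmxMr M (genmxE _)) -phiM (forall_inP (st a aA)).
  case/forall_inPn=> a aA /forall_inPn[h hH]; apply: add.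
  by rewrite expgS mem_mulg // (subsetP HA).
have [H [HA cH stH]] := step n; exists H; split=> // f [c fE] fH g.
have {}stH : stable H.
  case: stH => // dH g'; apply: submx_full; rewrite /row_full eqn_leq dH andbT.
  exact: rank_leq_col.
rewrite fE; have /sub_kermxP -> : (phi g <= kermx c)%MS; last by rewrite mxE.
apply: submx_trans (stH g) _; apply/sumsmx_subP => h hH; rewrite genmxE.
apply/sub_kermxP/rowP => j; rewrite ord1 -fE fH // mxE //.
Qed.

Section Operations.
Variables (n : nat) (phi : G -> 'rV[F]_n).

Lemma linear_inZ k f : linear_in phi f -> linear_in phi (fun g => k * f g).
Proof. by case=> c fE; exists (k *: c) => g; rewrite fE -scalemxAr [RHS]mxE. Qed.

Lemma linear_inD f1 f2 : linear_in phi f1 -> linear_in phi f2 ->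
  linear_in phi (fun g => f1 g + f2 g).
Proof. by move=> [c1 e1] [c2 e2]; exists (c1 + c2) => g; rewrite e1 e2 mulmxDr [RHS]mxE. Qed.

Lemma linear_in_ext f f' : f =1 f' -> linear_in phi f' -> linear_in phi f.
Proof. by move=> ff' [c cE]; exists c => g; rewrite ff'. Qed.

Lemma linear_inN f : linear_in phi f -> linear_in phi (fun g => - f g).
Proof. by move/(linear_inZ (-1)); apply: linear_in_ext => g; rewrite mulN1r. Qed.

Lemma linear_inB f f' :
  linear_in phi f -> linear_in phi f' -> linear_in phi (fun g => f g - f' g).
Proof. by move=> lf /linear_inN; apply: linear_inD. Qed.

Lemma linear_inZr k f : linear_in phi f -> linear_in phi (fun g => f g * k).
Proof. by move/(linear_inZ k); apply: linear_in_ext => g; rewrite mulrC. Qed.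

(** The tensor square of [phi], on which products of two linear functions become linear. *)
Definition square (g : G) : 'rV[F]_(n * n) := mxvec ((phi g)^T *m phi g).

Lemma square_equivariant : equivariant phi -> equivariant square.
Proof.
move=> eq_phi a; have [M phiM] := eq_phi a.
exists (lin_mx (mulmxr M \o mulmx M^T)) => g.
by rewrite mul_vec_lin /square /= phiM trmx_mul !mulmxA.
Qed.

Lemma linear_inM f1 f2 : linear_in phi f1 -> linear_in phi f2 ->
  linear_in square (fun g => f1 g * f2 g).
Proof.
move=> [c1 e1] [c2 e2]; exists (lin_mx (mulmxr c2 \o mulmx c1^T) : 'M_(_, 1 * 1)) => g.
pose L : 'M_n -> 'M_1 := mulmxr c2 \o mulmx c1^T.
transitivity (L ((phi g)^T *m phi g) 0 0); last first.
  by rewrite -mxvecE -mul_vec_lin; congr (_ _ _); rewrite [LHS]ord1.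
rewrite e1 e2 /L /=; set u := phi g *m c1.
have -> : (c1^T *m ((phi g)^T *m phi g) *m c2) = u^T *m (phi g *m c2).
  by rewrite trmx_mul !mulmxA.
by rewrite [RHS]mxE big_ord1 [u^T _ _]mxE.
Qed.

End Operations.
End Escape.

(** * Functions of degree two and four in the entries *)

Section QuarticFunctions.
Variable F : finFieldType.
Local Open Scope ring_scope.
Implicit Types x y z g h : SL2 F.

Definition entries (g : SL2 F) : 'rV[F]_(2 * 2) := mxvec (val g).
Definition quadratic := linear_in (square entries).
Definition quartic := linear_in (square (square entries)).

Lemma entries_equivariant : equivariant entries.
Proof.
by move=> a; exists (lin_mx (mulmx (val a))) => g; rewrite mul_vec_lin.
Qed.

Let linear_coord i j : linear_in entries (fun g => val g i j).
Proof.
exists (delta_mx (mxvec_index i j) 0) => g.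
by rewrite -colE [RHS]mxE mxvecE.
Qed.

Let linear_ent : (linear_in entries (@ea F) * linear_in entries (@eb F) *
  linear_in entries (@ec F) * linear_in entries (@ed F))%type.
Proof. by repeat split; apply: linear_coord. Qed.

Lemma quadratic_det : quadratic (fun g => ea g * ed g - eb g * ec g).
Proof. by have [[[la lb] lc] ld] := linear_ent; apply: linear_inB; apply: linear_inM. Qed.

(** Multiplication by the determinant, which is 1, raises the degree, so that a single degree serves
    all the escape conditions. *)
Lemma quartic_of_quadratic f : quadratic f -> quartic f.
Proof.
move=> qf; apply: linear_in_ext (linear_inM qf quadratic_det) => g.
by rewrite det2 mulr1.
Qed.

(** The inverse is the adjugate, whose entries are linear in those of [h]. *)
Lemma quadratic_conj x y :
  [/\ quadratic (fun h => ea (x * (h * y * h^-1))%g),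
      quadratic (fun h => eb (x * (h * y * h^-1))%g),
      quadratic (fun h => ec (x * (h * y * h^-1))%g) &
      quadratic (fun h => ed (x * (h * y * h^-1))%g)].
Proof.
have [[[la lb] lc] ld] := linear_ent.
have L (e1 e2 : SL2 F -> F) k1 k2 : linear_in entries e1 -> linear_in entries e2 ->
    linear_in entries (fun h => e1 h * k1 + e2 h * k2).
  by move=> l1 l2; apply: linear_inD; apply: linear_inZr.
have Q (e1 e2 e3 e4 : SL2 F -> F) : linear_in entries e1 -> linear_in entries e2 ->
    linear_in entries e3 -> linear_in entries e4 -> quadratic (fun h => e1 h * e2 h + e3 h * e4 h).
  by move=> l1 l2 l3 l4; apply: linear_inD; apply: linear_inM.
have qa : quadratic (fun h => ea (h * y * h^-1)%g).
  by apply: linear_in_ext (Q _ _ _ _ (L _ _ (ea y) (ec y) la lb) ld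
       (L _ _ (eb y) (ed y) la lb) (linear_inN lc)) => h; rewrite !entE.
have qb : quadratic (fun h => eb (h * y * h^-1)%g).
  by apply: linear_in_ext (Q _ _ _ _ (L _ _ (ea y) (ec y) la lb) (linear_inN lb)
       (L _ _ (eb y) (ed y) la lb) la) => h; rewrite !entE.
have qc : quadratic (fun h => ec (h * y * h^-1)%g).
  by apply: linear_in_ext (Q _ _ _ _ (L _ _ (ea y) (ec y) lc ld) ld
       (L _ _ (eb y) (ed y) lc ld) (linear_inN lc)) => h; rewrite !entE.
have qd : quadratic (fun h => ed (h * y * h^-1)%g).
  by apply: linear_in_ext (Q _ _ _ _ (L _ _ (ea y) (ec y) lc ld) (linear_inN lb)
       (L _ _ (eb y) (ed y) lc ld) la) => h; rewrite !entE.
have D k1 k2 (f1 f2 : SL2 F -> F) : quadratic f1 -> quadratic f2 ->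
    quadratic (fun h => k1 * f1 h + k2 * f2 h).
  by move=> q1 q2; apply: linear_inD; apply: linear_inZ.
split.
- by apply: linear_in_ext (D (ea x) (eb x) _ _ qa qc) => h; rewrite eaM.
- by apply: linear_in_ext (D (ea x) (eb x) _ _ qb qd) => h; rewrite ebM.
- by apply: linear_in_ext (D (ec x) (ed x) _ _ qa qc) => h; rewrite ecM.
- by apply: linear_in_ext (D (ec x) (ed x) _ _ qb qd) => h; rewrite edM.
Qed.

Lemma quartic_cdet g x z : quartic (fun h => cdet g (x * (h * z * h^-1))%g).
Proof.
have [qa qb qc qd] := quadratic_conj x z.
apply: linear_inD.
  by apply: linear_inM; apply: linear_inB; apply: linear_inZ.
apply: linear_inM; apply: linear_inB.
- exact: linear_inZ.
- by apply: linear_inZr; apply: linear_inB.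
- by apply: linear_inZ; apply: linear_inB.
- exact: linear_inZr.
Qed.

(** By [discE] this function is homogeneous in the entries in spite of the constant. *)
Lemma quadratic_disc : quadratic (fun g => tr g ^+ 2 - 4).
Proof.
have [[[la lb] lc] ld] := linear_ent.
apply: (@linear_in_ext _ _ _ _ _ (fun g => (ea g - ed g) * (ea g - ed g) + 4 * (eb g * ec g))).
  by move=> g; rewrite -discE expr2.
by apply: linear_inD; [apply: linear_inM; apply: linear_inB|apply: linear_inZ; apply: linear_inM].
Qed.

End QuarticFunctions.

Definition escaping (F : finFieldType) (H : {set SL2 F}) :=
  [/\ exists2 h, h \in H & (tr h ^+ 2 != 4)%R,
      forall x y, ~~ central y -> exists2 h, h \in H & ~~ central (x * (h * y * h^-1))%g &
      forall g x z, ~~ central g -> ~~ central z ->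
        exists2 h, h \in H & (cdet g (x * (h * z * h^-1))%g != 0)%R].

(** Each condition asks that a quartic function, not identically zero, be nonzero somewhere on [H].
    The bound [N] is the dimension of the fourth tensor power of the space of matrices. *)
Lemma exists_escaping : exists N, forall (F : finFieldType) (A : {set SL2 F}),
    (2%:R != 0 :> F)%R -> (3%:R != 0 :> F)%R -> 7 <= #|F| ->
    1%g \in A -> <<A>>%g = [set: SL2 F] ->
  exists H : {set SL2 F}, [/\ H \subset (A ^+ N)%g, #|H| <= N & escaping H].
Proof.
exists (2 * 2 * (2 * 2) * (2 * 2 * (2 * 2))) => F A F2 F3 F7 A1 genA.
have eqv := square_equivariant (square_equivariant (@entries_equivariant F)).
have [H [HA cH van]] := escape eqv A1 genA.
have nv f g : quartic f -> f g != 0%R -> exists2 h, h \in H & f h != 0%R.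
  move=> qf; have [/exists_inP//|/exists_inPn fH] := boolP [exists h in H, f h != 0%R].
  by rewrite (van f qf) ?eqxx // => h /fH/negbNE/eqP.
exists H; split=> //; split.
(* This matrix has trace 1, hence discriminant -3. *)
- have e : (0 * 1 - 1 * (-1) = 1 :> F)%R by ring.
  have [|h hH] := nv _ (mk e) (quartic_of_quadratic (quadratic_disc F)).
    rewrite /tr !entE; apply: contraNneq F3 => e3; apply/eqP.
    by apply: (lincomb1 (c := -1) e3)%R; ring.
  by rewrite subr_eq0 => h4; exists h.
- move=> x y /(exists_noncentral_conj F2 x)[g].
  have [qa qb qc qd] := quadratic_conj x y.
  rewrite /central !negb_and -subr_eq0 => /or3P[] g0.
  + have [h hH h0] := nv _ _ (quartic_of_quadratic (linear_inB qa qd)) g0.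
    by exists h; rewrite // /central !negb_and -subr_eq0 h0.
  + have [h hH h0] := nv _ _ (quartic_of_quadratic qb) g0.
    by exists h; rewrite // /central !negb_and h0 orbT.
  + have [h hH h0] := nv _ _ (quartic_of_quadratic qc) g0.
    by exists h; rewrite // /central !negb_and h0 !orbT.
- move=> g x z ng /(exists_cdet_conj F2 F3 F7 x ng)[h' h'0].
  by have [h hH h0] := nv _ _ (quartic_cdet g x z) h'0; exists h.
Qed.

(** * Dimension bound and pivoting *)

Section Counting.
Variables S T : finType.
Implicit Types (A : {set S}) (B : {set T}).

Lemma card_fibers A B (f : S -> T) c : {in A, forall x, f x \in B} ->
  (forall y, #|[set x in A | f x == y]| <= c) -> #|A| <= #|B| * c.
Proof.
move=> fAB fib; rewrite -sum1_card (partition_big f (mem B)) //=.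
rewrite -sum_nat_const; apply: leq_sum => y _.
by rewrite sum1dep_card; apply: leq_trans (fib y); rewrite cardsE.
Qed.

Lemma card_le2 A : {in A & &, forall x y z, [\/ x = y, y = z | z = x]} -> #|A| <= 2.
Proof.
move=> A3; rewrite leqNgt; apply/negP => /card_gt2P[x [y [z [[xA yA zA] [xy yz zx]]]]].
by have [e|e|e] := A3 x y z xA yA zA; [rewrite e eqxx in xy|rewrite e eqxx in yz|rewrite e eqxx in zx].
Qed.

End Counting.

(** Orbit-stabilizer for a set: elements of [A] that conjugate [b] alike differ by an element of
    [A^-1 * A] commuting with [b]. *)
Lemma card_conj (G : finGroupType) (A : {set G}) b :
  #|A| <= #|[set (a * b * a^-1)%g | a in A]| * #|(A^-1 * A :&: 'C[b])%g|.
Proof.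
apply: (@card_fibers _ _ _ _ (fun a => a * b * a^-1)%g) => [a aA|y].
  exact: imset_f.
have [->|[a0]] := set_0Vmem [set x in A | (x * b * x^-1)%g == y]; first by rewrite cards0.
rewrite inE => /andP[a0A /eqP ya0].
rewrite -(card_imset _ (mulgI a0^-1%g)); apply: subset_leq_card; apply/subsetP => _ /imsetP[a + ->].
rewrite inE -ya0 => /andP[aA /eqP e]; rewrite inE mem_mulg ?mem_invg ?invgK //=.
apply/cent1P; rewrite /commute.
have -> : (a0^-1 * a * b = a0^-1 * (a * b * a^-1) * a)%g by rewrite !mulgA mulgVK.
by rewrite e !mulgA mulVg mul1g.
Qed.

(** * Sizes of the center, of centralizers and of conjugacy classes *)

Section CardCentral.
Variable F : finFieldType.
Hypothesis F2 : (2%:R != 0 :> F)%R.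
Local Open Scope ring_scope.
Implicit Types x y z g h b : SL2 F.

Lemma central_eq x y z : central x -> central y -> central z -> [\/ x = y, y = z | z = x].
Proof.
have eqc (u v : SL2 F) : central u -> central v -> ea u = ea v -> u = v.
  by move=> /central1[_ e1 e2 e3] /central1[_ f1 f2 f3] e; apply: SL2_eq;
    rewrite ?e1 ?e2 ?e3 ?f1 ?f2 ?f3.
have pm (u v : SL2 F) : central u -> central v -> ea u = ea v \/ ea u = - ea v.
  move=> /central1[e _ _ _] /central1[f _ _ _].
  by have /eqP := etrans e (esym f); rewrite eqf_sqr => /orP[] /eqP; [left|right].
move=> cx cy cz; have [/eqc->|xy] := pm x y cx cy => //; first exact: Or31.
have [/eqc->|yz] := pm y z cy cz => //; first exact: Or32.
by apply: Or33; apply: eqc; rewrite // xy yz opprK.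
Qed.

(** The ratio [s] fixes the traceless part, and the discriminant then fixes the trace up to sign. *)
Lemma card_parallel b s (B : {set SL2 F}) : {in B, forall x, parallel b x s} -> (#|B| <= 2)%N.
Proof.
move=> Bs; apply: card_le2 => x y z /Bs xs /Bs ys /Bs zs.
have eqp (u v : SL2 F) : parallel b u s -> parallel b v s -> tr u = tr v -> u = v.
  by move=> [e1 e2 e3] [f1 f2 f3] e; apply: eq_of_tr; rewrite ?e1 ?e2 ?e3 ?f1 ?f2 ?f3.
have pm (u v : SL2 F) : parallel b u s -> parallel b v s -> tr u = tr v \/ tr u = - tr v.
  move=> /parallel_tr e /parallel_tr f.
  by have /eqP := addIr _ (etrans e (esym f)); rewrite eqf_sqr => /orP[] /eqP; [left|right].
have [/eqp->|xy] := pm x y xs ys => //; first exact: Or31.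
have [/eqp->|yz] := pm y z ys zs => //; first exact: Or32.
by apply: Or33; apply: eqp; rewrite // xy yz opprK.
Qed.

Lemma card_centralizer b : ~~ central b -> (#|('C[b])%g| <= 2 * #|F|)%N.
Proof.
move=> nb; rewrite mulnC -cardsT.
(* On the centralizer a ratio exists, so the default 0 is never taken there. *)
pose f x := odflt 0 [pick s | [&& ea x - ed x == s * (ea b - ed b), eb x == s * eb b & ec x == s * ec b]].
apply: (@card_fibers _ _ _ _ f) => [x _|s]; first by rewrite inE.
apply: (@card_parallel b s) => x; rewrite inE => /andP[/cent1P xb /eqP <-].
have [s' [e1 e2 e3]] := commute_parallel nb (esym xb).
rewrite /f; case: pickP => [s'' /and3P[/eqP ? /eqP ? /eqP ?]|/(_ s')]; first by split.
by rewrite e1 e2 e3 !eqxx.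
Qed.

(** The products [lower s * upper t * lower r] with [t != 0] are distinct: [t] is the upper right
    entry, and the diagonal gives [r] and [s]. *)
Lemma card_SL2_ge : ((#|F| - 1) * #|F| ^ 2 <= #|[set: SL2 F]|)%N.
Proof.
pose D := finset.setX (finset.setX [set~ (0 : F)] [set: F]) [set: F].
have -> : ((#|F| - 1) * #|F| ^ 2 = #|D|)%N.
  by rewrite !cardsX cardsC1 cardsT subn1 -mulnn mulnA.
pose f (u : F * F * F) := (lower u.2 * upper u.1.1 * lower u.1.2)%g.
rewrite -(card_in_imset (f := f)); first exact/subset_leq_card/finset.subsetT.
move=> [[t r] s] [[t' r'] s'] /setXP[/setXP[+ _] _] _ e.
have := (congr1 (@ea _) e, congr1 (@eb _) e, congr1 (@ed _) e).
rewrite /f /lower /upper !entE /= !inE => -[[e1 e2] e3] t0.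
have tt : t = t' by apply: (lincomb1 (c := 1) e2); ring.
rewrite -tt in e1 e2 e3 *.
have -> : r = r' by apply: (mulfI t0); apply: (lincomb1 (c := 1) e1); ring.
by have -> : s = s' by apply: (mulfI t0); apply: (lincomb1 (c := 1) e3); ring.
Qed.

Lemma card_conj_class b : ~~ central b ->
  ((#|F| - 1) * #|F| <= 2 * #|[set (g * b * g^-1)%g | g in [set: SL2 F]]|)%N.
Proof.
move=> nb; have F0 : (0 < #|F|)%N by apply/card_gt0P; exists 0.
rewrite -(leq_pmul2r F0) -mulnA mulnn (leq_trans card_SL2_ge) //.
apply: leq_trans (card_conj _ b) _; rewrite -mulnA mulnCA leq_mul2l; apply/orP; right.
apply: leq_trans (card_centralizer nb); apply: subset_leq_card; exact: subsetIr.
Qed.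

End CardCentral.

(** * Dimension bound for traces, and the pivot argument *)

Section Pivot.
Variable F : finFieldType.
Hypothesis F2 : (2%:R != 0 :> F)%R.
Variables (A H : {set SL2 F}) (N : nat).
Hypotheses (A1 : 1%g \in A) (AV : A^-1%g = A) (genA : <<A>>%g = [set: SL2 F]).
Hypotheses (HA : H \subset (A ^+ N)%g) (cardH : #|H| <= N) (escH : escaping H).
Local Open Scope group_scope.
Implicit Types x y z g h b : SL2 F.

(* From [x h y] and [x h' z] one recovers the traces of [x], [y] and [z] as those of
   [x^-1], [x^-1 (x h y) h^-1] and [x^-1 (x h' z) h'^-1], hence [x] up to two choices. *)
Lemma card_trace_class j m t : 2 * j + N <= m -> (t ^+ 2 != 4)%R ->
  #|[set x in A ^+ j | tr x == t]| ^ 3 <= 2 * N ^ 2 * #|A ^+ m| ^ 2.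
Proof.
move=> jm t4; set B := [set x in _ | _].
have BA x : x \in B -> x \in A ^+ j by rewrite inE => /andP[].
have Bt x : x \in B -> tr x = t by rewrite inE => /andP[_ /eqP].
clearbody B; have nB x : x \in B -> ~~ central x.
  by move=> xB; apply: contra t4 => /central_tr; rewrite Bt // => ->.
have [_ esc1 esc2] := escH.
(* [hh] and [kk] choose escaping elements; for the arguments considered in [hhP] and [kkP] the
   default 1 is never taken. *)
pose hh (u : SL2 F * SL2 F) := odflt 1 [pick h in H | ~~ central (u.1 * (h * u.2 * h^-1))].
have hhP x y : x \in B -> y \in B -> (hh (x, y) \in H) /\
    ~~ central (x * (hh (x, y) * y * (hh (x, y))^-1)).
  move=> xB yB; rewrite /hh; case: pickP => [h /andP[]//|none].
  by have [h hH hc] := esc1 x y (nB y yB); have := none h; rewrite /= hH hc.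
pose kk (g : SL2 F) (u : SL2 F * SL2 F) :=
  odflt 1 [pick h in H | cdet g (u.1 * (h * u.2 * h^-1)) != 0%R].
have kkP g x z : z \in B -> ~~ central g -> (kk g (x, z) \in H) /\
    cdet g (x * (kk g (x, z) * z * (kk g (x, z))^-1)) != 0%R.
  move=> zB ng; rewrite /kk; case: pickP => [h /andP[]//|none].
  by have [h hH hc] := esc2 g x z ng (nB z zB); have := none h; rewrite /= hH hc.
pose h1 (u : SL2 F * SL2 F * SL2 F) := hh u.1.
pose g1 (u : SL2 F * SL2 F * SL2 F) := u.1.1 * (h1 u * u.1.2 * (h1 u)^-1).
pose h2 u := kk (g1 u) (u.1.1, u.2).
(* The chosen elements are recorded along with the two products, so that on a fiber they are
   constant. *)
pose f u := ((h1 u, h2 u), (u.1.1 * h1 u * u.1.2, u.1.1 * h2 u * u.2)).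
have mem3 x h y : x \in B -> h \in H -> y \in B -> x * h * y \in A ^+ m.
  move=> xB hH yB; apply: (subsetP (expgs_sub A1 jm)).
  have -> : (2 * j + N = j + N + j)%N by lia.
  by rewrite !expgsD_mem ?BA // (subsetP HA).
have B3 : #|finset.setX (finset.setX B B) B| = (#|B| ^ 3)%N.
  by rewrite !cardsX !expnS expn0 muln1 mulnA.
rewrite -B3.
have := @card_fibers _ _ (finset.setX (finset.setX B B) B)
  (finset.setX (finset.setX H H) (finset.setX (A ^+ m) (A ^+ m))) f 2.
rewrite !cardsX => cf; apply: leq_trans (cf _ _) _ => {cf}; last 1 first.
- by rewrite mulnC -[leqRHS]mulnA leq_pmul2l // -!mulnn !leq_mul.
- case=> [[x y] z]; rewrite !inE /= => /andP[/andP[xB yB] zB].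
  have [hH hc] := hhP x y xB yB; have [kH kc] := kkP _ x z zB hc.
  by rewrite /f /g1 /h2 /h1 /= hH kH !mem3.
move=> w; apply: card_le2 => -[[x1 y1] z1] [[x2 y2] z2] [[x3 y3] z3].
rewrite !inE => /andP[/andP[/andP[x1B y1B] z1B] /eqP e1].
move=> /andP[/andP[/andP[x2B y2B] z2B] /eqP e2] /andP[/andP[/andP[x3B y3B] z3B] /eqP e3].
rewrite /= in x1B y1B z1B x2B y2B z2B x3B y3B z3B.
case: w e1 e2 e3 => [[h k] [g g']] e1 e2 e3.
have sol x y z : x \in B -> y \in B -> z \in B -> f ((x, y), z) = ((h, k), (g, g')) ->
   [/\ cdet (g * h^-1) (g' * k^-1) != 0%R, tr x^-1 = t, tr (x^-1 * (g * h^-1)) = t &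
       tr (x^-1 * (g' * k^-1)) = t] /\ (y = h^-1 * x^-1 * g) * (z = k^-1 * x^-1 * g').
  move=> xB yB zB; have [hH hc] := hhP x y xB yB; have [kH kc] := kkP _ x z zB hc.
  move: kc; rewrite /f /h2 /g1 /h1 /=.
  set h' := hh _; set k' := kk _ _ => kc -[<- <- <- <-]; split; last first.
    by split; rewrite !mulgA ?mulgVK ?mulVg ?mul1g // -!mulgA mulKg mulKg.
  rewrite trV Bt //; split=> //; first by move: kc; rewrite !mulgA.
    by rewrite !mulgA mulVg mul1g tr_conj Bt.
  by rewrite !mulgA mulVg mul1g tr_conj Bt.
have [[nz a1 a2 a3] [-> ->]] := sol _ _ _ x1B y1B z1B e1.
have [[_ b1 b2 b3] [-> ->]] := sol _ _ _ x2B y2B z2B e2.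
have [[_ c1 c2 c3] [-> ->]] := sol _ _ _ x3B y3B z3B e3.
have [||||||/invg_inj->|/invg_inj->|/invg_inj->] := @trace_solutions F _ _ x1^-1 x2^-1 x3^-1 nz.
all: rewrite ?a1 ?a2 ?a3 //.
- exact: Or31.
- exact: Or32.
- exact: Or33.
Qed.

(** The conjugates of [b] by [A] lie in [A ^+ (k + 2)] and share its trace, so [card_trace_class]
    bounds their number, and [card_conj] bounds the centralizer from below. *)
Lemma card_rich b k m : b \in A ^+ k -> (tr b ^+ 2 != 4)%R -> 2 * (k + 2) + N <= m ->
  #|A| ^ 3 <= #|A ^+ 2 :&: 'C[b]| ^ 3 * (2 * N ^ 2) * #|A ^+ m| ^ 2.
Proof.
move=> bA b4 km; have := card_conj A b.
have -> : A^-1 * A = A ^+ 2 by rewrite AV.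
set I := imset _ _ => le.
have leI : #|I| <= #|[set x in A ^+ (k + 2) | tr x == tr b]|.
  apply: subset_leq_card; apply/subsetP => _ /imsetP[a aA ->].
  rewrite inE tr_conj eqxx andbT.
  have -> : (k + 2 = 1 + k + 1)%N by lia.
  by rewrite !expgsD_mem // ?expg1 // -AV inE invgK.
rewrite -mulnA.
apply: leq_trans (leq_mul (leqnn _) (card_trace_class km b4)).
by rewrite -expnMn leq_exp2r // (leq_trans le) // mulnC leq_mul.
Qed.

Definition torus g0 g := A ^+ 2 :&: 'C[g * g0 * g^-1].
Definition involved g0 g := [exists b in torus g0 g, ~~ central b].

(** A noncentral [b] in the torus has the same centralizer as [g * g0 * g^-1], and unlike the latter
    it is known to lie in [A ^+ 2]. *)
Lemma card_torus_involved g0 g m : (tr g0 ^+ 2 != 4)%R -> 8 + N <= m -> involved g0 g ->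
  #|A| ^ 3 <= #|torus g0 g| ^ 3 * (2 * N ^ 2) * #|A ^+ m| ^ 2.
Proof.
move=> t0 mN /exists_inP[b]; rewrite inE => /andP[bA /cent1P bC] nb.
have ng : ~~ central (g * g0 * g^-1).
  by rewrite centralJ; apply: contra t0 => /central_tr->.
have tb : (tr b ^+ 2 != 4)%R by apply: (commute_tr ng (esym bC)) => //; rewrite tr_conj.
have -> : torus g0 g = A ^+ 2 :&: 'C[b].
  congr (_ :&: _); apply/setP => x; apply/cent1P/cent1P => xC.
    exact/esym/(commute_trans ng (esym bC) (esym xC)).
  exact/esym/(commute_trans nb bC (esym xC)).
exact: card_rich bA tb mN.
Qed.

(* Translates of [A] by the conjugate torus overlap at most twice when that torus meets
   [A ^+ 2] only in the center. *)
Lemma card_not_involved g0 g a m : 5 <= m -> a \in A -> ~~ involved g0 (a * g) ->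
  #|A| * #|torus g0 g| <= 2 * #|A ^+ m|.
Proof.
move=> m5 aA /exists_inPn niv; rewrite -cardsX mulnC.
apply: (@card_fibers _ _ _ _ (fun u => u.1 * (a * u.2 * a^-1))) => [[x d]|w].
  rewrite !inE /= => /andP[xA /andP[dA _]].
  apply: (subsetP (expgs_sub A1 m5)); apply: (@expgsD_mem _ _ 1 4); rewrite ?expg1 //.
  apply: (@expgsD_mem _ _ 3 1); last by rewrite expg1 -AV inE invgK.
  by apply: (@expgsD_mem _ _ 1 2); rewrite ?expg1.
have key x d x' d' : x \in A -> x' \in A -> d \in torus g0 g -> d' \in torus g0 g ->
    x * (a * d * a^-1) = x' * (a * d' * a^-1) -> central (x^-1 * x').
  move=> xA x'A /setIP[_ dC] /setIP[_ d'C] e.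
  apply/negbNE/niv; rewrite inE; apply/andP; split.
    by apply: (@expgsD_mem _ _ 1 1); rewrite expg1 // -AV inE invgK.
  have -> : x^-1 * x' = a * (d * d'^-1) * a^-1.
    apply: (mulgI x); rewrite mulKVg; apply: (mulIg (a * d' * a^-1)).
    by rewrite -e !mulgA !mulgVK.
  have dd : (d * d'^-1) * (g * g0 * g^-1) = (g * g0 * g^-1) * (d * d'^-1).
    by apply/cent1P; rewrite groupM ?groupV.
  apply/cent1P; rewrite /commute.
  transitivity (a * ((d * d'^-1) * (g * g0 * g^-1)) * a^-1).
    by rewrite invMg !mulgA !mulgVK.
  by rewrite dd invMg !mulgA !mulgVK.
apply: card_le2 => -[x1 d1] [x2 d2] [x3 d3] /setIdP[/setXP[xA1 dA1] /eqP e1].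
move=> /setIdP[/setXP[xA2 dA2] /eqP e2] /setIdP[/setXP[xA3 dA3] /eqP e3].
have eqd x d d' : x * (a * d * a^-1) = x * (a * d' * a^-1) -> d = d'.
  by move=> /mulgI/mulIg/mulgI.
have c1 := key _ _ _ _ xA1 xA1 dA1 dA1 erefl.
have c2 := key _ _ _ _ xA1 xA2 dA1 dA2 (etrans e1 (esym e2)).
have c3 := key _ _ _ _ xA1 xA3 dA1 dA3 (etrans e1 (esym e3)).
have [/mulgI ex|/mulgI ex|/mulgI ex] := central_eq c1 c2 c3.
- by move: (etrans e1 (esym e2)); rewrite -ex => /= /eqd->; apply: Or31.
- by move: (etrans e2 (esym e3)); rewrite -ex => /= /eqd->; apply: Or32.
- by move: (etrans e3 (esym e1)); rewrite -ex => /= /eqd->; apply: Or33.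
Qed.

(* Each noncentral element lies in a single torus, which contains at most two conjugates
   of [g0]. *)
Lemma card_all_involved g0 m r : (tr g0 ^+ 2 != 4)%R -> 2 <= m -> (forall g, r <= #|torus g0 g|) ->
  #|[set g * g0 * g^-1 | g in [set: SL2 F]]| * (r - 2) <= 2 * #|A ^+ m|.
Proof.
move=> t0 m2 rT; set Cl := imset _ _.
pose P := [set u in finset.setX Cl (A ^+ 2) | ~~ central u.2 && (u.2 \in 'C[u.1])].
apply: (@leq_trans #|P|); last first.
  rewrite mulnC; apply: (leq_trans _ (leq_mul (subset_leq_card (expgs_sub A1 m2)) (leqnn 2))).
  apply: (@card_fibers _ _ _ _ snd) => [[y b]|b].
    by case/setIdP=> /setXP[].
  apply: card_le2 => -[y1 b1] [y2 b2] [y3 b3].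
  have ClP y : y \in Cl -> tr y = tr g0 by case/imsetP=> g _ ->; rewrite tr_conj.
  move=> /setIdP[/setIdP[/setXP[/ClP t1 _] /andP[nb /cent1P c1]] /eqP/= e1]; subst b1.
  move=> /setIdP[/setIdP[/setXP[/ClP t2 _] /andP[_ /cent1P c2]] /eqP/= e2]; subst b2.
  move=> /setIdP[/setIdP[/setXP[/ClP t3 _] /andP[_ /cent1P c3]] /eqP/= e3]; subst b3.
  rewrite /= in c1 c2 c3.
  have [||->|e2] := commute_same_tr F2 nb c1 c2; rewrite ?t1 ?t2 //; first exact: Or31.
  have [||->|e3] := commute_same_tr F2 nb c1 c3; rewrite ?t1 ?t3 //; first exact: Or33.
  by apply: Or32; rewrite e2 e3.
rewrite -sum_nat_const /P -sum1_card.
rewrite (partition_big (fun u : SL2 F * SL2 F => u.1) (mem Cl)) /=; last first.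
  by case=> y b /setIdP[/setXP[]].
apply: leq_sum => _ /imsetP[g _ ->]; rewrite sum1dep_card.
have c2 : #|A ^+ 2 :&: 'C[g * g0 * g^-1] :&: [set b | central b]| <= 2.
  by apply: card_le2 => x y z; rewrite !inE => /andP[_ cx] /andP[_ cy] /andP[_ cz];
    apply: central_eq.
apply: (@leq_trans #|A ^+ 2 :&: 'C[g * g0 * g^-1] :\: [set b | central b]|).
  rewrite leq_subLR (leq_trans (rT g)) // /torus.
  by rewrite -[leqLHS](cardsID [set b | central b]) leq_add2r.
have pair_inj : injective (pair (g * g0 * g^-1) : SL2 F -> _) by move=> b b' [].
rewrite -(card_imset _ pair_inj).
apply: subset_leq_card; apply/subsetP => _ /imsetP[b + ->].
case/setDP=> /setIP[bA bC]; rewrite inE => nb.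
by rewrite inE /= eqxx andbT inE in_setX /= bA bC nb (imset_f (fun g => g * g0 * g^-1)) ?inE.
Qed.

Lemma pivot m : 3 * N + 8 <= m ->
  let K := (24 ^ 3 * (2 * N ^ 2))%N in
  #|A| ^ 6 <= K * #|A ^+ m| ^ 5 \/ #|F| ^ 6 * #|A| ^ 3 <= K * #|A ^+ m| ^ 5.
Proof.
move=> mN K; have [[g0 g0H t0] _ _] := escH.
have ng0 : ~~ central g0 by apply: contra t0 => /central_tr->.
have nM : #|A| <= #|A ^+ m|.
  by rewrite -{1}[A]expg1; apply: subset_leq_card; apply: expgs_sub => //; lia.
pose M := #|A ^+ m|; pose C := (2 * N ^ 2)%N.
(* A torus meeting [A ^+ 2] in at most two elements already makes [A ^+ m] large. *)
have small r : r <= 2 -> #|A| ^ 3 <= r ^ 3 * C * M ^ 2 -> #|A| ^ 6 <= K * M ^ 5.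
  move=> r2 le; have {}le : #|A| ^ 3 <= 8 * C * M ^ 2.
    by apply: leq_trans le _; rewrite !leq_mul2r (leq_exp2r r 2) // r2 !orbT.
  have nM3 : #|A| ^ 3 <= M ^ 3 by rewrite leq_exp2r.
  apply: (@leq_trans (8 * C * M ^ 2 * M ^ 3)); first by rewrite (expnD _ 3 3) leq_mul.
  by rewrite -mulnA -expnD leq_mul2r leq_mul ?orbT.
have rich1 : #|A| ^ 3 <= #|torus g0 1| ^ 3 * C * M ^ 2.
  by rewrite /torus mul1g invg1 mulg1; apply: (card_rich (subsetP HA _ g0H) t0); lia.
have [r2|r3] := leqP #|torus g0 1| 2; first by left; apply: small r2 rich1.
have inv1 : involved g0 1.
  apply: contraLR r3 => /exists_inPn niv; rewrite -leqNgt; apply: card_le2 => x y z.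
  by move=> /niv/negbNE cx /niv/negbNE cy /niv/negbNE cz; apply: central_eq.
have richP g : involved g0 g -> #|A| ^ 3 <= #|torus g0 g| ^ 3 * C * M ^ 2.
  by apply: card_torus_involved => //; lia.
(* The pivot: either some generator carries an involved torus to one that is not, or involvement
   spreads from 1 to the whole group. *)
have [/exists_inP[a aA /existsP[g /andP[ivg nivg]]]|/exists_inPn closed] :=
    boolP [exists a in A, [exists g, involved g0 g && ~~ involved g0 (a * g)]].
  left; have nr : #|A| * #|torus g0 g| <= 2 * M by apply: card_not_involved aA nivg; lia.
  apply: (@leq_trans ((#|A| * #|torus g0 g|) ^ 3 * (C * M ^ 2))).
    by rewrite (expnD _ 3 3) expnMn -mulnA leq_mul2l [leqRHS]mulnA richP ?orbT.
  apply: (@leq_trans ((2 * M) ^ 3 * (C * M ^ 2))); first by rewrite leq_mul2r leq_exp2r ?nr ?orbT.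
  rewrite expnMn mulnACA -expnD leq_mul2r; apply/orP; right.
  by rewrite leq_mul2r leq_exp2r ?orbT.
have all_inv g : involved g0 g.
  apply: (gen_ind genA (P := fun g => involved g0 g)) => // a h aA ivh.
  by have /existsPn/(_ h) := closed a aA; rewrite ivh => /negbNE.
(* The smallest intersection bounds all the others from below and, its torus being involved, is
   itself bounded below in terms of [#|A|]. *)
pose g := [arg min_(h < 1) #|torus g0 h|].
have gmin h : #|torus g0 g| <= #|torus g0 h| by rewrite /g; case: arg_minnP => // i _ ->.
have [r2|{}r3] := leqP #|torus g0 g| 2; first by left; apply: small r2 (richP _ _).
right; have Cl1 := card_conj_class F2 ng0.
set r := #|torus g0 g| in r3; have m2 : 2 <= m by lia.
have Cl2 := card_all_involved t0 m2 gmin; rewrite -/r -/M in Cl2.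
set Cl := #|_| in Cl1 Cl2.
have F0 : 1 < #|F| by apply: (@leq_trans #|[set (0 : F)%R; 1%R]|);
  [rewrite cards2 eq_sym oner_eq0|exact: max_card].
(* Here 24 is [4 * 3 * 2]: [#|F| ^ 2 <= 4 * #|Cl|], [r <= 3 * (r - 2)], and the factor 2 of
   [card_all_involved]. *)
have qr : #|F| ^ 2 * r <= 24 * M.
  have r6 : r <= 3 * (r - 2) by lia.
  have q2 : #|F| ^ 2 <= 2 * ((#|F| - 1) * #|F|) by nia.
  by apply: leq_trans (leq_mul q2 r6) _; nia.
apply: (@leq_trans ((#|F| ^ 2 * r) ^ 3 * (C * M ^ 2))).
  by rewrite expnMn -expnM -mulnA leq_mul2l [leqRHS]mulnA richP ?orbT.
apply: (@leq_trans ((24 * M) ^ 3 * (C * M ^ 2))); first by rewrite leq_mul2r leq_exp2r ?qr ?orbT.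
by rewrite expnMn mulnACA -expnD leqnn.
Qed.

End Pivot.

(** * Large sets *)

(** Cauchy-Schwarz, by summing the inequality of the two means over all pairs. *)
Lemma sum_sqr_le (T : finType) (Y : {set T}) (r : T -> nat) :
  (\sum_(s in Y) r s) ^ 2 <= #|Y| * \sum_(s in Y) r s ^ 2.
Proof.
rewrite -(leq_pmul2l (isT : 0 < 2)) -mulnn big_distrlr /= big_distrr /=.
have -> : 2 * (#|Y| * \sum_(s in Y) r s ^ 2) = \sum_(s in Y) \sum_(t in Y) (r s ^ 2 + r t ^ 2).
  rewrite [RHS](eq_bigr (fun s => #|Y| * r s ^ 2 + \sum_(t in Y) r t ^ 2)); last first.
    by move=> s _; rewrite big_split /= sum_nat_const.
  by rewrite big_split /= sum_nat_const -big_distrr /= addnn mul2n.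
apply: leq_sum => s _; rewrite big_distrr /=; apply: leq_sum => t _.
exact: nat_Cauchy.
Qed.

(** * Sumsets and additive energy *)

Section Sumset.
Variable F : finFieldType.
Implicit Types X L : {set F}.
Local Open Scope ring_scope.

Definition dilate_sum X (mu : F) : {set F} := [set u.1 + mu * u.2 | u in finset.setX X X].

Let reps X (mu s : F) := #|[set u in finset.setX X X | u.1 + mu * u.2 == s]|.
Let energy X (mu : F) := (\sum_s reps X mu s ^ 2)%N.

(** Cauchy-Schwarz for the representation counts, whose total is [#|X| ^ 2]. *)
Let energy_ge X mu : (#|X| ^ 4 <= #|dilate_sum X mu| * energy X mu)%N.
Proof.
have -> : (#|X| ^ 4 = (\sum_(s in dilate_sum X mu) reps X mu s) ^ 2)%N.
  rewrite (_ : (\sum_(s in _) _ = #|X| ^ 2)%N) -?expnM //.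
  rewrite -mulnn -cardsX -sum1_card.
  rewrite (partition_big (fun u : F * F => u.1 + mu * u.2) (mem (dilate_sum X mu))) /=.
    by apply: eq_bigr => s _; rewrite sum1dep_card.
  by move=> u uX; apply: imset_f.
apply: leq_trans (sum_sqr_le _ _) _; rewrite leq_mul2l; apply/orP; right.
by rewrite /energy [leqRHS](bigID (mem (dilate_sum X mu))) /= leq_addr.
Qed.

(** Two distinct pairs collide for at most one [mu], whereas equal pairs collide for all of them. *)
Let sum_energy X : (\sum_mu energy X mu <= #|X| ^ 4 + #|F| * #|X| ^ 2)%N.
Proof.
have energyE mu : energy X mu = (\sum_(u in finset.setX X X) \sum_(v in finset.setX X X)
    (u.1 + mu * u.2 == v.1 + mu * v.2)%R)%N.
  rewrite /energy (eq_bigr (fun s => \sum_(u in finset.setX X X) (u.1 + mu * u.2 == s)%R * reps X mu s)%N).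
    rewrite exchange_big /=; apply: eq_bigr => u _.
    rewrite (bigD1 (u.1 + mu * u.2)) //= eqxx mul1n big1 ?addn0.
      by rewrite /reps -sum1dep_card big_mkcondr /=; apply: eq_bigr => v _; rewrite eq_sym; case: eqP.
    by move=> s; rewrite eq_sym => /negPf->.
  move=> s _; rewrite -big_distrl /= -mulnn; congr (_ * _)%N.
  by rewrite /reps -sum1dep_card big_mkcondr /=; apply: eq_bigr => v _; case: eqP.
rewrite (eq_bigr _ (fun mu _ => energyE mu)) exchange_big /=.
have -> : (#|X| ^ 4 + #|F| * #|X| ^ 2 = \sum_(u in finset.setX X X) \sum_(v in finset.setX X X)
    (1 + #|F| * (u == v)))%N.
  rewrite [RHS](eq_bigr (fun=> #|X| ^ 2 + #|F|)%N).
    by rewrite sum_nat_const cardsX mulnn mulnDr -expnD [in LHS]mulnC.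
  move=> u uX; rewrite big_split /= sum1_card cardsX mulnn; congr (_ + _)%N.
  rewrite (bigD1 u) //= eqxx muln1 big1 ?addn0 // => v /andP[_].
  by rewrite eq_sym => /negPf->; rewrite muln0.
apply: leq_sum => u _; rewrite exchange_big /=; apply: leq_sum => v _.
have [->|uv] := eqVneq u v.
  rewrite (eq_bigr (fun=> 1%N)) => [|mu _]; last by rewrite eqxx.
  by rewrite sum1_card muln1 leq_addl.
rewrite muln0 addn0 -big_mkcond /= sum1_card.
apply/card_le1_eqP => mu nu; rewrite !unfold_in /= => /eqP e1 /eqP e2.
have [e|ne] := eqVneq u.2 v.2.
  by case/eqP: uv; move: e1; rewrite e => /addIr; case: u v e {e2} => [? ?] [? ?] /= -> ->.
have ne' : u.2 - v.2 != 0 by rewrite subr_eq0.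
by apply: (mulIf ne'); apply: (lincomb2 (c1 := -1) (c2 := 1) e1 e2); ring.
Qed.

(* Averaging the additive energy over all dilates shows that the dilates in a large enough
   set [L] cannot all have a small sumset. *)
Lemma large_dilate_sum X L : (#|F| ^ 2 < #|X| ^ 2 * #|L|)%N ->
  exists2 mu, mu \in L & (#|F| < 2 * #|dilate_sum X mu|)%N.
Proof.
move=> XL; apply/exists_inP; apply: contraLR XL => /exists_inPn small; rewrite -leqNgt.
have X0 : (0 < #|X| \/ #|X| = 0)%N by lia.
case: X0 => X0; last by rewrite X0.
(* Every dilate has energy at least [#|X| ^ 4 / #|F|]; a small sumset, assumed for [mu] in [L],
   doubles this. *)
have lower mu : ((1 + (mu \in L)) * #|X| ^ 4 <= #|F| * energy X mu)%N.
  have le := energy_ge X mu; have [muL|_] := boolP (mu \in L).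
    have := small _ muL; rewrite -leqNgt => le2.
    apply: leq_trans (leq_mul (leqnn 2) le) _; rewrite mulnA.
    by rewrite leq_mul2r le2 orbT.
  rewrite addn0 mul1n (leq_trans le) // leq_mul2r max_card orbT //.
have : (\sum_mu (1 + (mu \in L)) * #|X| ^ 4 <= #|F| * (#|X| ^ 4 + #|F| * #|X| ^ 2))%N.
  apply: (@leq_trans (\sum_mu #|F| * energy X mu)%N); first by apply: leq_sum.
  by rewrite -big_distrr leq_mul2l sum_energy orbT.
rewrite -big_distrl /= big_split /= sum1_card -big_mkcond /= sum1_card mulnDl mulnDr leq_add2l.
rewrite mulnA mulnn -[4%N]/(2 + 2)%N expnD mulnA leq_pmul2r ?expn_gt0 ?X0 // mulnC.
by rewrite [X in (_ <= X)%N]mulnC.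
Qed.

End Sumset.

(** * Unipotent elements in powers of a large set *)

Section LargeSets.
Variable F : finFieldType.
Implicit Types (x y z g h b : SL2 F) (A : {set SL2 F}).
Local Open Scope group_scope.

Lemma upperD (s t : F) : upper (s + t)%R = upper s * upper t.
Proof. by rewrite /upper; apply: SL2_eq; rewrite !entE; ring. Qed.

(** Upper triangular elements thus provide the dilates for [large_dilate_sum]. *)
Lemma conj_upper b (s : F) : ec b = 0%R -> b * upper s * b^-1 = upper (ea b ^+ 2 * s)%R.
Proof.
move=> c0; have := det2 b; rewrite c0 mulr0 subr0 => ad.
apply: SL2_eq; rewrite /upper !entE ?c0.
- by apply: (lincomb1 (c := 1%R) ad); ring.
- by ring.
- by ring.
- by apply: (lincomb1 (c := 1%R) ad); ring.
Qed.

Let mulV2 A x y : A^-1 = A -> x \in A -> y \in A -> x^-1 * y \in A ^+ 2.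
Proof. by move=> AV xA yA; apply: (@expgsD_mem _ _ 1 1); rewrite expg1 // -AV inE invgK. Qed.

(* The fibers of the first column are the cosets of the upper unipotent group. *)
Lemma card_le_upper A : A^-1 = A ->
  #|A| <= #|F| ^ 2 * #|[set s : F | upper s \in A ^+ 2]|.
Proof.
move=> AV; rewrite -mulnn -[#|F|]cardsT -cardsX.
apply: (@card_fibers _ _ _ _ (fun g => (ea g, ec g))) => [g _|w]; first by rewrite !inE.
have [->|[g0 /setIdP[g0A /eqP/= e0]]] := set_0Vmem [set x in A | (ea x, ec x) == w].
  by rewrite cards0.
have up g : ea g = ea g0 -> ec g = ec g0 -> g0^-1 * g = upper (eb (g0^-1 * g)).
  move=> ea_eq ec_eq; have d0 := det2 g0; have d := det2 g; rewrite ea_eq ec_eq in d.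
  apply: SL2_eq; rewrite /upper !entE ?ea_eq ?ec_eq.
  - by apply: (lincomb1 (c := 1%R) d0); ring.
  - by [].
  - by ring.
  - by apply: (lincomb1 (c := 1%R) d); ring.
have fib g : g \in [set x in A | (ea x, ec x) == w] -> g0^-1 * g = upper (eb (g0^-1 * g)).
  by case/setIdP=> _; rewrite -e0 => /eqP[]; apply: up.
rewrite -(card_in_imset (f := fun g => eb (g0^-1 * g))).
  apply: subset_leq_card; apply/subsetP => _ /imsetP[g gw ->].
  by rewrite inE -fib // mulV2 //; case/setIdP: gw.
by move=> g h /fib gE /fib hE e; apply: (mulgI g0^-1); rewrite gE hE e.
Qed.

(** The first column is sent to a point of the projective line, coded in [bool * F]; elements with
    the same point differ by an upper triangular matrix. *)
Lemma card_le_borel A : A^-1 = A ->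
  #|A| <= 2 * #|F| * #|[set g in A ^+ 2 | ec g == 0%R]|.
Proof.
move=> AV.
have -> : (2 * #|F|)%N = #|finset.setX [set: bool] [set: F]| by rewrite cardsX !cardsT card_bool.
pose f g := if ec g == 0%R then (true, 0%R) else (false, ea g / ec g)%R.
apply: (@card_fibers _ _ _ _ f) => [g _|w]; first by rewrite !inE.
have [->|[g0 /setIdP[g0A /eqP/= e0]]] := set_0Vmem [set x in A | f x == w].
  by rewrite cards0.
rewrite -(card_imset _ (mulgI g0^-1)); apply: subset_leq_card.
apply/subsetP => _ /imsetP[g + ->]; case/setIdP=> gA; rewrite -e0 => /eqP fg.
apply/setIdP; split; first exact: mulV2.
rewrite !entE; move: fg; rewrite /f.
have [-> | n0] := eqVneq (ec g) 0%R; have [-> | n1] := eqVneq (ec g0) 0%R => //.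
  by rewrite oppr0 mul0r mulr0 addr0 eqxx.
case=> e; apply/eqP.
have {}e : (ea g * ec g0 = ea g0 * ec g)%R.
  by rewrite -[ea g](divfK n0) e -mulrA [(ec g * _)%R]mulrC mulrA divfK.
by apply: (lincomb1 (c := (-1)%R) e); ring.
Qed.

(** The square leaves only the sign of [ea g] and the entry [eb g] free. *)
Lemma card_le_squares (B : {set SL2 F}) : {in B, forall g, ec g = 0%R} ->
  #|B| <= 2 * #|F| * #|[set (ea g ^+ 2)%R | g in B]|.
Proof.
move=> B0; rewrite mulnC; apply: (@card_fibers _ _ _ _ (fun g => ea g ^+ 2)%R) => [g gB|w].
  exact: imset_f.
have [->|[g0 /setIdP[_ /eqP/= e0]]] := set_0Vmem [set x in B | (ea x ^+ 2 == w)%R].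
  by rewrite cards0.
have -> : (2 * #|F|)%N = #|finset.setX [set: bool] [set: F]| by rewrite cardsX !cardsT card_bool.
rewrite -(card_in_imset (f := fun g => (ea g == ea g0, eb g))).
  by apply: subset_leq_card; apply/subsetP => u _; rewrite !inE.
have sgn g : (ea g ^+ 2)%R = w -> ea g = (if ea g == ea g0 then ea g0 else - ea g0)%R.
  by case: eqVneq => // ne /eqP; rewrite -e0 eqf_sqr (negPf ne) => /eqP.
move=> g h /setIdP[gB /eqP eg] /setIdP[hB /eqP eh] [e1 e2].
have e : ea g = ea h by rewrite (sgn _ eg) (sgn _ eh) e1.
have dg := det2 g; have dh := det2 h; rewrite B0 // mulr0 subr0 in dg.
rewrite (B0 h) // mulr0 subr0 in dh.
have a0 : ea h != 0%R by apply: contraTneq (oner_neq0 F) => a0; rewrite -dh a0 mul0r eqxx.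
apply: SL2_eq; rewrite ?e ?e2 ?(B0 g) ?(B0 h) //.
by apply: (mulfI a0); rewrite dh -e dg.
Qed.

Lemma upper_fill A : 1 \in A -> A^-1 = A -> 4 * #|F| ^ 8 < #|A| ^ 3 ->
  forall s : F, upper s \in A ^+ 16.
Proof.
move=> A1 AV lA.
have le1 := card_le_upper AV; have le2 := card_le_borel AV.
pose X := [set s : F | upper s \in A ^+ 2]; rewrite -/X in le1.
pose B := [set g in A ^+ 2 | ec g == 0%R]; rewrite -/B in le2.
have B0 : {in B, forall g, ec g = 0%R} by move=> g /setIdP[_ /eqP].
have le3 := card_le_squares B0; set L := imset _ _ in le3.
have F0 : 0 < #|F| by apply/card_gt0P; exists 0%R.
(* The bounds [#|A| <= #|F| ^ 2 * #|X|], squared, and [#|A| <= 4 * #|F| ^ 2 * #|L|] are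
   multiplied. *)
have XL : #|F| ^ 2 < #|X| ^ 2 * #|L|.
  have lL : #|A| <= 4 * #|F| ^ 2 * #|L|.
    by apply: leq_trans le2 _; apply: leq_trans (leq_mul (leqnn _) le3) _; nia.
  have lX : #|A| ^ 2 <= (#|F| ^ 2 * #|X|) ^ 2 by rewrite leq_exp2r.
  have := leq_mul lX lL; rewrite -expnSr => /(leq_trans lA).
  have -> : ((#|F| ^ 2 * #|X|) ^ 2 * (4 * #|F| ^ 2 * #|L|) = 4 * #|F| ^ 6 * (#|X| ^ 2 * #|L|))%N.
    by rewrite expnMn -expnM; ring.
  have -> : (4 * #|F| ^ 8 = 4 * #|F| ^ 6 * #|F| ^ 2)%N by rewrite -mulnA -expnD.
  by rewrite ltn_pmul2l // muln_gt0 expn_gt0 F0.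
have [mu /imsetP[b bB ->] lY] := large_dilate_sum XL.
set Y := dilate_sum _ _ in lY.
have YA t : t \in Y -> upper t \in A ^+ 8.
  case/imsetP=> -[u v] /setXP[]; rewrite !inE /= => uA vA ->.
  rewrite upperD -conj_upper ?B0 //; case/setIdP: bB => bA _.
  apply: (@expgsD_mem _ _ 2 6) => //; apply: (@expgsD_mem _ _ 4 2); last exact: expgsV_mem.
  exact: (@expgsD_mem _ _ 2 2).
(* [Y] and [s - Y] each fill more than half of the field, hence meet. *)
clearbody Y => s; have : ~~ [disjoint Y & [set (s - t)%R | t in Y]].
  apply/negP; rewrite -setI_eq0 => /eqP YY.
  have inj : injective (fun t => s - t)%R by move=> t t' /addrI/oppr_inj.
  have := cardsUI Y [set (s - t)%R | t in Y]; rewrite YY cards0 addn0 card_imset // => YU.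
  by move: lY; rewrite ltnNge mul2n -addnn -YU max_card.
rewrite -setI_eq0 => /set0Pn[t /setIP[tY /imsetP[t' t'Y e]]].
have -> : s = (t + t')%R by rewrite e subrK.
by rewrite upperD (@expgsD_mem _ _ 8 8) ?YA.
Qed.

Lemma lower_conj : exists w : SL2 F, forall s, lower s = w * upper (- s)%R * w^-1.
Proof.
have e : (0 * 0 - 1 * (-1) = 1 :> F)%R by ring.
by exists (mk e) => t; apply: SL2_eq; rewrite /lower /upper !entE; ring.
Qed.

Lemma conjs_expg A w n : (A :^ w) ^+ n = A ^+ n :^ w.
Proof.
elim: n => [|n IHn]; first by rewrite !expg0 conjs1g.
by rewrite !expgS IHn conjsMg.
Qed.

Lemma large_set_fills A : 1 \in A -> A^-1 = A -> 4 * #|F| ^ 8 < #|A| ^ 3 ->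
  A ^+ 64 = [set: SL2 F].
Proof.
move=> A1 AV lA; have up := upper_fill A1 AV lA.
(* The hypotheses on [A] pass to its conjugates, so [upper_fill] applies to the conjugate by the
   fixed [w]. *)
have low s : lower s \in A ^+ 16.
  have [w ->] := lower_conj.
  have Aw1 : 1 \in A :^ w by rewrite mem_conjg conj1g.
  have AwV : (A :^ w)^-1 = A :^ w
    by apply/setP => g; rewrite inE !mem_conjg conjVg -{1}AV inE invgK.
  have := upper_fill Aw1 AwV; rewrite cardJg => /(_ lA (- s)%R).
  by rewrite conjs_expg mem_conjg conjgE invgK mulgA.
(* Such an element is a product lower, upper, lower; when [eb g] vanishes, one more upper factor is
   split off below. *)
have nz g : eb g != 0%R -> g \in A ^+ 48.
  move=> b0; have -> : g = lower ((ed g - 1) / eb g)%R * upper (eb g) * lower ((ea g - 1) / eb g)%R.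
    have d := det2 g; apply: SL2_eq; rewrite /lower /upper !entE.
    - by rewrite !(mul0r, mul1r, mulr1, addr0, mulr0) [(eb g * _)%R]mulrC divfK // addrC subrK.
    - by ring.
    - apply: (mulIf b0); rewrite -[in LHS](mulrC (eb g)).
      have -> : (eb g * ec g = ea g * ed g - 1)%R by rewrite -d; ring.
      by field.
    - by rewrite !(mul0r, mul1r, mulr1, addr0, mulr0, add0r) divfK // subrK.
  by apply: (@expgsD_mem _ _ 32 16) => //; apply: (@expgsD_mem _ _ 16 16).
apply/eqP; rewrite eqEsubset finset.subsetT; apply/subsetP => g _.
have [b0|b0] := eqVneq (eb g) 0%R; last first.
  exact: (subsetP (expgs_sub A1 (isT : 48 <= 64))) (nz g b0).
rewrite -[g](mulgK (upper 1%R)) (@expgsD_mem _ _ 48 16) ?expgsV_mem // nz //.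
rewrite /upper !entE b0 mul0r addr0 mulr1.
by apply: contraTneq (oner_neq0 F) => a0; rewrite -(det2 g) a0 b0 !mul0r subrr eqxx.
Qed.

End LargeSets.

(** * The product theorem *)

(** If the growth fails, the eighth powers of the two cases of [pivot] give [#|A| ^ 7 <= K ^ 8],
    excluded by [n0], or [#|F| ^ 48 <= K ^ 8 * #|A| ^ 17]. As 48/17 exceeds 8/3, the latter makes
    [A] large enough for [large_set_fills]. *)
Lemma product_theorem : exists m n0 q0, forall (F : finFieldType) (A : {set SL2 F}),
    (2%:R != 0 :> F)%R -> (3%:R != 0 :> F)%R -> q0 <= #|F| ->
    1%g \in A -> A^-1%g = A -> <<A>>%g = [set: SL2 F] -> n0 <= #|A| ->
  (A ^+ m)%g = [set: SL2 F] \/ #|A| ^ 41 <= #|(A ^+ m)%g| ^ 40.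
Proof.
have [N escN] := exists_escaping.
pose K := 24 ^ 3 * (2 * N ^ 2); pose q1 := K ^ 24 * 4 ^ 17.
exists (3 * N + 64), (K ^ 8).+1, (maxn 7 q1.+1).
move=> F A F2 F3; rewrite geq_max => /andP[F7 qF] A1 AV genA nA.
have [H [HA cH eH]] := escN F A F2 F3 F7 A1 genA.
set m := 3 * N + 64; set M := #|(A ^+ m)%g|.
have [le|MA] := leqP (#|A| ^ 41) (M ^ 40); [by right|left].
have n0 : 0 < #|A| by apply: leq_trans nA.
have q0 : 0 < #|F| by apply: leq_trans qF.
have step a b c : a <= K * M ^ 5 -> a ^ 8 = b * #|A| ^ c -> b * #|A| ^ c <= K ^ 8 * #|A| ^ 41.
  move=> le <-; apply: (@leq_trans ((K * M ^ 5) ^ 8)); first by rewrite leq_exp2r.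
  by rewrite expnMn -expnM leq_mul2l (ltnW MA) orbT.
have [] := pivot F2 A1 AV genA HA cH eH (m := m) (leq_add (leqnn _) (isT : 8 <= 64)).
  have e : (#|A| ^ 6) ^ 8 = #|A| ^ 7 * #|A| ^ 41 by rewrite -expnM -expnD.
  move=> /step/(_ e); rewrite leq_pmul2r ?expn_gt0 ?n0 // leqNgt.
  by rewrite (leq_trans nA) // -{1}[#|A|]expn1 leq_pexp2l.
rewrite -/K -/M => le.
have {le}qn : #|F| ^ 48 <= K ^ 8 * #|A| ^ 17.
  have e : (#|F| ^ 6 * #|A| ^ 3) ^ 8 = #|F| ^ 48 * #|A| ^ 24 by rewrite expnMn -!expnM.
  have := step _ _ _ le e.
  by rewrite (expnD #|A| 17 24) mulnA leq_pmul2r // expn_gt0 n0.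
suff lA : 4 * #|F| ^ 8 < #|A| ^ 3.
  apply/eqP; rewrite eqEsubset finset.subsetT -(large_set_fills A1 AV lA) expgs_sub //.
  exact: leq_addl.
rewrite ltnNge; apply/negP => le.
have : #|F| ^ 144 <= q1 * #|F| ^ 136.
  have le17 : #|A| ^ 51 <= 4 ^ 17 * #|F| ^ 136.
    by rewrite (expnM _ 3 17) (expnM _ 8 17) -expnMn leq_exp2r.
  apply: (@leq_trans ((K ^ 8 * #|A| ^ 17) ^ 3)).
    by rewrite (expnM _ 48 3) leq_exp2r.
  by rewrite expnMn -!expnM /q1 -mulnA leq_mul2l le17 orbT.
rewrite (expnD _ 8 136) leq_pmul2r ?expn_gt0 ?q0 // leqNgt (leq_trans qF) //.
by rewrite -{1}[#|F|]expn1 leq_pexp2l.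
Qed.

(** Bernoulli's inequality for the powers of 41/40. *)
Lemma exists_expn_ratio c : exists j, c * 40 ^ j <= 41 ^ j.
Proof.
exists (40 * c); have bern j : (40 + j) * 40 ^ j <= 40 * 41 ^ j.
  elim: j => [|j IHj]; first by rewrite !expn0 addn0.
  rewrite !expnS; have := leq_mul (leqnn 41) IHj.
  have : 40 ^ j > 0 by rewrite expn_gt0.
  move: (40 ^ j) (41 ^ j) => a b; nia.
have := bern (40 * c); have : 40 ^ (40 * c) > 0 by rewrite expn_gt0.
move: (40 ^ _) (41 ^ _) => a b; nia.
Qed.

Lemma card_SL2_le (F : finFieldType) : #|[set: SL2 F]| <= #|F| ^ 4.
Proof. by rewrite cardsT -(card_mx F 2 2) (leq_card (val : SL2 F -> 'M_2) val_inj). Qed.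

(** Iterating the product theorem raises the size to the power 41/40 each time. After [J] steps
    without filling the group it would reach [#|F| ^ 5], beyond the bound of [card_SL2_le]. *)
Lemma bounded_power_fills D : exists k q0, forall (F : finFieldType) (A : {set SL2 F}),
    (2%:R != 0 :> F)%R -> (3%:R != 0 :> F)%R -> q0 <= #|F| ->
    1%g \in A -> A^-1%g = A -> <<A>>%g = [set: SL2 F] -> #|F| <= #|A| ^ D ->
  (A ^+ k)%g = [set: SL2 F].
Proof.
have [m [n0 [q0 prod]]] := product_theorem.
have [J JP] := exists_expn_ratio (5 * D).
exists (m ^ J.+1), (maxn q0 (maxn 2 (n0 ^ D).+1)) => F A F2 F3.
rewrite !geq_max => /and3P[qF F1 nF] A1 AV genA AD.
have nA : n0 <= #|A|.
  rewrite leqNgt; apply/negP => lt; have := leq_trans nF AD; rewrite ltnNge.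
  by case: (D) => [|d]; rewrite ?expn0 // leq_exp2r // ltnW.
have A0 : 1 < #|A|.
  rewrite ltnNge; apply/negP => cA; have := leq_trans F1 AD.
  by case: (D) => [|d]; rewrite ?expn0 // leqNgt ltnS -(exp1n d.+1) leq_exp2r ?cA.
have m0 : 0 < m.
  case: posnP prod => // -> /(_ F A F2 F3 qF A1 AV genA nA); rewrite expg0 => -[eT|].
    by have := subset_leq_card (finset.subsetT A); rewrite -eT cards1 leqNgt A0.
  by rewrite cards1 exp1n leqNgt -{1}(exp1n 41) ltn_exp2r ?A0.
have grow j : (A ^+ (m ^ j.+1))%g = [set: SL2 F] \/
    #|A| ^ (41 ^ j) <= #|(A ^+ (m ^ j))%g| ^ (40 ^ j).
  elim: j => [|j [full|IHj]]; first by right; rewrite !expn0.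
    left; apply/eqP; rewrite eqEsubset finset.subsetT -full expgs_sub //.
    by rewrite leq_pexp2l.
  set B := (A ^+ (m ^ j))%g in IHj.
  have B1 : 1%g \in B by apply: expgs1.
  have BV : B^-1%g = B.
    apply/setP => g; rewrite inE; apply/idP/idP => gB; last exact: expgsV_mem.
    by rewrite -[g]invgK expgsV_mem.
  have AB : A \subset B by rewrite -{1}[A]expg1 expgs_sub // expn_gt0 m0.
  have genB : <<B>>%g = [set: SL2 F].
    by apply/eqP; rewrite eqEsubset finset.subsetT -genA genS.
  have := prod F B F2 F3 qF B1 BV genB (leq_trans nA (subset_leq_card AB)).
  rewrite -expgM -expnSr => -[full|le]; [left|right].
    apply/eqP; rewrite eqEsubset finset.subsetT -full expgs_sub //.
    by rewrite leq_pexp2l.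
  rewrite expnSr expnM; apply: (@leq_trans ((#|B| ^ 40 ^ j) ^ 41)); first by rewrite leq_exp2r.
  by rewrite -expnM mulnC expnM [40 ^ j.+1]expnS expnM leq_exp2r // expn_gt0.
have [//|le] := grow J.
have J0 : 0 < 40 ^ J by rewrite expn_gt0.
have : #|F| ^ (5 * 40 ^ J) <= #|F| ^ (4 * 40 ^ J).
  apply: (@leq_trans (#|A| ^ (41 ^ J))).
    apply: (@leq_trans ((#|A| ^ D) ^ (5 * 40 ^ J))); first by rewrite leq_exp2r // muln_gt0 J0.
    by rewrite -expnM leq_pexp2l ?(ltnW A0) // mulnA [D * 5]mulnC.
  apply: leq_trans le _; rewrite expnM leq_exp2r //.
  exact: leq_trans (subset_leq_card (finset.subsetT _)) (card_SL2_le F).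
by rewrite leq_exp2l // leq_pmul2r.
Qed.

(** * Free groups *)

Section ReducedWords.
Variable G : groupType.
Local Notation word := (seq (G * bool)).
Implicit Types (l m f e : G * bool) (u v w : word).

Definition linv l : G * bool := (l.1, ~~ l.2).
Definition winv w : word := rev [seq linv l | l <- w].

Lemma linvK : involutive linv.
Proof. by case=> x b; rewrite /linv /= negbK. Qed.

Lemma linv_neq l : linv l != l.
Proof. by case: l => x b; rewrite /linv xpair_eqE eqxx /=; case: b. Qed.

Lemma winvK : involutive winv.
Proof. by move=> w; rewrite /winv map_rev revK mapK //; apply: linvK. Qed.

Lemma winv_cat u v : winv (u ++ v) = winv v ++ winv u.
Proof. by rewrite /winv map_cat rev_cat. Qed.

Lemma size_winv w : size (winv w) = size w.
Proof. by rewrite size_rev size_map. Qed.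

Lemma winv_rcons w l : winv (rcons w l) = linv l :: winv w.
Proof. by rewrite /winv map_rcons rev_rcons. Qed.

Lemma winv_cons w l : winv (l :: w) = rcons (winv w) (linv l).
Proof. by rewrite /winv /= rev_cons. Qed.

Definition compat l m := ~~ ((l.1 == m.1) && (l.2 != m.2)).

Lemma compatE l m : compat l m = (m != linv l).
Proof.
by case: l m => x b [y c]; rewrite /compat /linv xpair_eqE /= eq_sym; case: eqP; case: b; case: c.
Qed.

Lemma reduced2 l m : reduced [:: l; m] = compat l m.
Proof. exact: andbT. Qed.

Lemma compat_refl l : compat l l.
Proof. by rewrite compatE eq_sym linv_neq. Qed.

Lemma reduced_junction u l m v :
  reduced (rcons u l ++ m :: v) = [&& reduced (rcons u l), compat l m & reduced (m :: v)].
Proof.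
case: u => [|x u]; rewrite /reduced /=; first by rewrite -/(compat _ _).
by rewrite cat_path last_rcons /= -/(compat _ _).
Qed.

Lemma reduced_cat u v : reduced (u ++ v) -> reduced u /\ reduced v.
Proof. by move=> /cat_sorted2[]. Qed.

(** Induction on the last letter of [u]: it either meets [v] without cancelling or cancels its first
    letter. The word [s] collects what cancels. *)
Lemma cancellation u v : reduced u -> reduced v ->
  exists u' s v', [/\ u = u' ++ s, v = winv s ++ v' & reduced (u' ++ v')].
Proof.
elim/last_ind: u v => [|u l IHu] v ru rv; first by exists [::], [::], v.
case: v rv => [|m v] rv; first by exists (rcons u l), [::], [::]; rewrite !cats0.
have [lm|] := boolP (compat l m).
  by exists (rcons u l), [::], (m :: v); rewrite cats0 reduced_junction ru lm rv.
rewrite compatE negbK => /eqP ml.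
have [ru' _] : reduced u /\ reduced [:: l] by apply: reduced_cat; rewrite cats1.
have [_ rv'] : reduced [:: m] /\ reduced v by apply: reduced_cat.
have [u' [s [v' [-> -> r]]]] := IHu v ru' rv'.
by exists u', (rcons s l), v'; rewrite rcons_cat winv_rcons ml.
Qed.

(** The outer letters are mutually inverse and can be stripped; a single letter is not its own
    inverse, and two mutually inverse letters are not reduced. *)
Lemma reduced_eq_winv w : reduced w -> w = winv w -> w = [::].
Proof.
have [n] := ubnP (size w); elim: n w => // n IHn [//|l w] /=; rewrite ltnS.
case/lastP: w => [|w m]; first by rewrite /winv /= => _ _ [/eqP]; rewrite eq_sym (negPf (linv_neq l)).
rewrite size_rcons => le r; rewrite winv_cons winv_rcons rcons_cons => -[lm] /rcons_inj[ww _].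
have [_ rwm] : reduced [:: l] /\ reduced (rcons w m) by apply: reduced_cat.
have [rw _] : reduced w /\ reduced [:: m] by apply: reduced_cat; rewrite cats1.
have w0 := IHn w (ltnW le) rw ww.
have : reduced [:: l; m] by move: r; rewrite w0.
by rewrite reduced2 compatE lm linvK eqxx.
Qed.

(** Mutually inverse outer letters are moved into [c] until the two ends no longer cancel. *)
Lemma cyclic_reduction w : reduced w -> w != [::] ->
  exists c w', [/\ w = c ++ w' ++ winv c, w' != [::] & reduced (w' ++ w')].
Proof.
have [n] := ubnP (size w); elim: n w => // n IHn [//|l w] /=; rewrite ltnS.
case/lastP: w => [|w m]; first by move=> _ _ _; exists [::], [:: l]; split=> //;
  rewrite [_ ++ _]/(cat _ _) reduced2 compat_refl.
rewrite size_rcons => le r _.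
have [_ rwm] : reduced [:: l] /\ reduced (rcons w m) by apply: reduced_cat.
have [rw _] : reduced w /\ reduced [:: m] by apply: reduced_cat; rewrite cats1.
have [ml|] := boolP (compat m l).
  exists [::], (l :: rcons w m); split; rewrite ?cats0 //.
  by rewrite -{1}rcons_cons reduced_junction rcons_cons ml andbb.
rewrite compatE negbK => /eqP ml.
have w0 : w != [::].
  apply: contraTneq r => ->; rewrite -[path _ _ _]/(reduced [:: l; m]).
  by rewrite reduced2 compatE ml linvK eqxx.
have [c [w' [wE w'0 rw']]] := IHn w (ltnW le) rw w0.
exists (l :: c), w'; split=> //.
by rewrite winv_cons ml linvK wE -!cats1 /= -!catA.
Qed.

(* When [compat e f], such words can be multiplied without cancellation. *)
Definition spanning f e w := [&& w != [::], reduced w, head e w == f & last f w == e].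

Lemma spanning_cat f e u v : compat e f -> spanning f e u -> spanning f e v ->
  spanning f e (u ++ v).
Proof.
move=> ef /and4P[u0 ru hu lu] /and4P[v0 rv hv lv].
apply/and4P; split.
- by case: (u) u0.
- case/lastP: u u0 ru lu {hu} => // u l _ ru; rewrite last_rcons => /eqP le.
  case: v v0 rv hv {lv} => // m v _ rv /= /eqP mf.
  by rewrite reduced_junction ru rv le mf ef.
- by case: (u) u0 hu.
- by rewrite last_cat; case: (v) v0 lv.
Qed.

Lemma spanning_flatten f e (ws : seq word) : compat e f -> all (spanning f e) ws ->
  reduced (flatten ws).
Proof.
move=> ef; case: ws => // w ws.
suff: all (spanning f e) (w :: ws) -> spanning f e (flatten (w :: ws)).
  by move=> sp /sp/and4P[].
elim: ws w => [|w' ws IHws] w /=; first by rewrite cats0 andbT.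
by case/andP=> sw sws; apply: spanning_cat => //; apply: IHws.
Qed.

Lemma spanning_nseq f e w n : compat e f -> spanning f e w -> spanning f e (flatten (nseq n.+1 w)).
Proof. by move=> ef sw; elim: n => [|n IHn]; rewrite /= ?cats0 // spanning_cat. Qed.

(* If a long initial segment of [g] reappeared inverted at the end of [u ++ v], it would
   contain a nonempty word equal to its own inverse. *)
Lemma short_cancellation u v s p r z : reduced u -> size v < size u ->
  u ++ s = winv r ++ z -> u ++ v = p ++ r -> size r < size u.
Proof.
move=> ru vu e1 e2; rewrite ltnNge; apply/negP => ur.
pose y := drop (size u) (winv r).
have rE : winv r = u ++ y.
  rewrite -{1}(cat_take_drop (size u) (winv r)); congr (_ ++ _).
  by have := congr1 (take (size u)) e1; rewrite take_size_cat // takel_cat // size_winv.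
pose u1 := take (size v) u; pose u2 := drop (size v) u.
have uE : u = u1 ++ u2 by rewrite cat_take_drop.
have su1 : size u1 = size v by rewrite size_takel // ltnW.
have rE' : r = winv y ++ winv u by rewrite -winv_cat -rE winvK.
have /eqP : u1 ++ (u2 ++ v) = (p ++ winv y) ++ winv u by rewrite catA -uE e2 rE' catA.
rewrite eqseq_cat; last first.
  have := congr1 size e2; rewrite rE' !size_cat !size_winv su1.
  by rewrite addnA [size u + _]addnC => /addIn.
case/andP=> _; rewrite {1}uE winv_cat eqseq_cat ?size_winv // => /andP[/eqP u2E _].
have ru2 : reduced u2 by move: ru; rewrite uE => /reduced_cat[].
by have := congr1 size uE; rewrite (reduced_eq_winv ru2 u2E) cats0 su1; lia.
Qed.

End ReducedWords.

From mathcomp Require Import boolp classical_sets reals exp.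

(** * A free semigroup of rank two in a free group *)

Section FreeSemigroups.
Variable G : groupType.
Local Open Scope group_scope.
Implicit Types (x y : G) (u v w : seq (G * bool)).

Lemma word_val_cat u v : word_val (u ++ v) = word_val u * word_val v.
Proof. exact: big_cat. Qed.

Lemma word_val_winv w : word_val (winv w) = (word_val w)^-1.
Proof.
elim: w => [|l w IHw]; first by rewrite /word_val !big_nil invg1.
rewrite winv_cons -cats1 word_val_cat IHw /word_val big_seq1 big_cons invMg.
by case: l => x []; rewrite /letter_val /= ?invgK.
Qed.

Lemma word_val_nseq n w : word_val (flatten (nseq n w)) = word_val w ^+ n.
Proof.
elim: n => [|n IHn]; first by rewrite /word_val big_nil.
by rewrite /= word_val_cat IHn expgS.
Qed.

Variables (X H : set G).
Hypotheses (sgH : is_subgroup H) (freeH : is_free_basis X H).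

Lemma word_over_cat u v : word_over X (u ++ v) <-> word_over X u /\ word_over X v.
Proof.
split=> [uv|[Xu Xv] l]; last by rewrite mem_cat => /orP[/Xu|/Xv].
by split=> l lw; apply: uv; rewrite mem_cat lw ?orbT.
Qed.

Lemma word_val_in w : word_over X w -> H (word_val w).
Proof.
have [H1 HM HV] := sgH; have [XH _] := freeH.
elim: w => [|l w IHw] Xlw; first by rewrite /word_val big_nil.
rewrite /word_val big_cons; apply: HM; last first.
  by apply: IHw => m mw; apply: Xlw; rewrite inE mw orbT.
have /XH Hl : X l.1 by apply: Xlw; rewrite inE eqxx.
by rewrite /letter_val; case: l.2 => //; apply: HV.
Qed.

Lemma reduced_word_inj u v : word_over X u -> word_over X v -> reduced u -> reduced v ->
  word_val u = word_val v -> u = v.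
Proof.
move=> Xu Xv ru rv e; have [_ uniqH] := freeH.
have [w [_ wU]] := uniqH _ (word_val_in Xu).
by rewrite -(wU u) // (wU v).
Qed.

(* After conjugation [a] is a cyclically reduced word; then for large [n] the reduced word of
   [a ^+ n * b * a ^+ n] begins and ends like [a], so that the products of these two
   words involve no cancellation. *)
Lemma free_semigroup a b : H a -> H b -> a * b <> b * a ->
  exists n, let c := a ^+ n * b * a ^+ n in
    forall s t : seq bool, size s = size t ->
      \prod_(i <- s) (if i then a * c else c * a) = \prod_(i <- t) (if i then a * c else c * a) ->
    s = t.
Proof.
have half_lt (i j k l m : nat) : 2 * i < j -> j = k + l -> i = l + m -> m < k by lia.
have [H1 HM HV] := sgH; have [XH uniqH] := freeH => Ha Hb ab.
have word h : H h -> exists w, [/\ word_over X w, reduced w & word_val w = h].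
  by case/uniqH=> w [wP _]; exists w.
have [wa [Xwa rwa waE]] := word a Ha.
have wa0 : wa != [::].
  by apply: contra_notN ab => /eqP wa0; rewrite -waE wa0 /word_val big_nil mul1g mulg1.
have [k [w [waE' w0 rww]]] := cyclic_reduction rwa wa0.
move: Xwa; rewrite waE' => /word_over_cat[Xk /word_over_cat[Xw _]].
pose g := word_val k; pose a' := word_val w; pose b' := g^-1 * b * g.
have aE : a = g * a' * g^-1 by rewrite -waE waE' !word_val_cat word_val_winv mulgA.
have Hg : H g by apply: word_val_in.
have [wb [Xwb rwb wbE]] : exists w, [/\ word_over X w, reduced w & word_val w = b'].
  by apply: word; apply: (HM _ _ (HM _ _ (HV _ Hg) Hb) Hg).
have [f [e [ef spw]]] : exists f e, compat e f /\ spanning f e w.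
  case: (w) w0 rww => // f w1 _; rewrite lastI; move: (last _ _) (belast _ _) => e w2 rww.
  have [rw _] := reduced_cat rww.
  move: rww rw; rewrite {2}(_ : rcons w2 e = head f (rcons w2 e) :: behead (rcons w2 e)); last first.
    by case: (w2).
  rewrite reduced_junction => /and3P[_ ef _] rw; exists (head f (rcons w2 e)), e; split=> //.
  rewrite /spanning rw last_rcons eqxx /=.
  by case: (w2) => [|? ?] /=; rewrite eqxx.
(* More than twice the length of [wb], so that more than half of the left power survives the
   cancellation against [wb]. *)
pose n := (2 * size wb).+1; pose gw := flatten (nseq n w).
have spg : spanning f e gw by apply: spanning_nseq.
have /and4P[g0 rg hg lg] := spg.
have sg : n <= size gw.
  rewrite size_flatten /shape map_nseq sumn_nseq leq_pmull // lt0n size_eq0 //.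
have Xg : word_over X gw.
  rewrite /gw; elim: (n) => [|m IHm] //=; by apply/word_over_cat.
have [u [s [v [gE bE ruv]]]] := cancellation rg rwb.
have [p [r [z [uvE gE' rpz]]]] := cancellation ruv rg.
have suv : size v < size u.
  have sgw : size gw = size u + size s by rewrite -size_cat -gE.
  have sb : size wb = size s + size v by rewrite bE size_cat size_winv.
  exact: (half_lt (size wb) (size gw) (size u) (size s)).
have ru : reduced u by have [] := reduced_cat ruv.
have rlt := short_cancellation ru suv (etrans (esym gE) gE') uvE.
pose q := p ++ z.
have p0 : p != [::].
  apply: contraTneq rlt => p0; have := congr1 size uvE; rewrite p0 size_cat /= => <-.
  by rewrite -leqNgt leq_addr.
have z0 : z != [::].
  apply: contraTneq rlt => z0; have := congr1 size gE'; rewrite z0 cats0 size_winv gE size_cat => <-.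
  by rewrite -leqNgt leq_addr.
have u0 : u != [::] by case: (u) suv.
have spq : spanning f e q.
  apply/and4P; split=> //.
  - by rewrite /q; case: (p) p0.
  - move: hg; rewrite gE /q; case: (u) u0 uvE => // m u' _; case: (p) p0 => //= m' p' _ [-> _].
    by [].
  - by move: lg; rewrite gE' /q !last_cat; case: (z) z0.
have qE : word_val q = a' ^+ n * b' * a' ^+ n.
  rewrite -word_val_nseq -/gw -wbE.
  have -> : word_val gw * word_val wb = word_val (u ++ v).
    by rewrite gE bE !word_val_cat word_val_winv mulgA mulgK.
  by rewrite uvE gE' !word_val_cat word_val_winv mulgA mulgK.
have Xq : word_over X q.
  have [Xu _] : word_over X u /\ word_over X s by apply/word_over_cat; rewrite -gE.
  have [_ Xv] : word_over X (winv s) /\ word_over X v by apply/word_over_cat; rewrite -bE.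
  have [Xp _] : word_over X p /\ word_over X r.
    by apply/word_over_cat; rewrite -uvE; apply/word_over_cat.
  have [_ Xz] : word_over X (winv r) /\ word_over X z by apply/word_over_cat; rewrite -gE'.
  exact/word_over_cat.
(* Distinct words of equal length which concatenate without cancellation, so that a product of them
   can be parsed. *)
clearbody q; pose P := w ++ q; pose Q := q ++ w.
have sPQ : size P = size Q by rewrite !size_cat addnC.
have PQ : P != Q.
  apply: contra_notN ab => /eqP/(congr1 (@word_val G)); rewrite !word_val_cat qE -/a'.
  rewrite !mulgA => eab; have cn : a' ^+ n * a' = a' * a' ^+ n by rewrite -expgSr expgS.
  have {}eab : a' * b' = b' * a'.
    apply: (mulgI (a' ^+ n)); apply: (mulIg (a' ^+ n)).
    by rewrite !mulgA cn eab -[LHS]mulgA cn !mulgA.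
  move: eab; rewrite /b' aE => /(congr1 (fun x => g * x * g^-1)).
  by rewrite !mulgA mulgV mul1g mulgK.
pose W (s : seq bool) := flatten [seq if i then P else Q | i <- s].
have XW (t : seq bool) : word_over X (W t).
  elim: t => [|i t IHt]; first by [].
  by apply/word_over_cat; split=> //; case: i; apply/word_over_cat.
have rW (t : seq bool) : reduced (W t).
  apply: (spanning_flatten ef); apply/allP => _ /mapP[[] _ ->]; exact: spanning_cat.
have Winj (t t' : seq bool) : size t = size t' -> W t = W t' -> t = t'.
  elim: t t' => [|i t IHt] [|i' t'] //= [st] /eqP; rewrite /W /= eqseq_cat; last first.
    by case: i; case: i'.
  case/andP=> ii /eqP/(IHt _ st) ->; congr (_ :: _).
  by case: i ii; case: i'; rewrite ?(negPf PQ) // eq_sym (negPf PQ).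
exists n => c t t' st.
have prodE (l : seq bool) : \prod_(i <- l) (if i then a * c else c * a) = g * word_val (W l) * g^-1.
  have cE : c = g * word_val q * g^-1.
    have aX m : a ^+ m = g * a' ^+ m * g^-1.
      elim: m => [|m IHm]; first by rewrite !expg0 mulg1 mulgV.
      by rewrite !expgS IHm aE !mulgA mulgVK.
    by rewrite qE /c aX /b' !mulgA.
  clearbody c.
  elim: l => [|i l IHl]; first by rewrite big_nil /W /word_val big_nil mulg1 mulgV.
  have -> : word_val (W (i :: l)) = word_val (if i then P else Q) * word_val (W l).
    exact: word_val_cat.
  rewrite big_cons IHl !mulgA; congr (_ * _ * _).
  by case: i; rewrite word_val_cat cE -/a' aE !mulgA !mulgVK.
rewrite !prodE => /mulIg/mulgI eW; apply: Winj => //.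
exact: reduced_word_inj eW.
Qed.

End FreeSemigroups.

(** * Reduction modulo p and the diameter *)

Section IntegerMatrices.
Implicit Types x y : SL2 int.

Definition norm x : nat := `|ea x| + `|eb x| + `|ec x| + `|ed x|.

Lemma norm_mul x y : norm (x * y)%g <= norm x * norm y.
Proof.
have tri (a b c d : int) : `|(a * b + c * d)%R| <= `|a| * `|b| + `|c| * `|d|.
  by rewrite -!abszM; lia.
rewrite /norm !entE.
apply: leq_trans (leq_add (leq_add (leq_add (tri _ _ _ _) (tri _ _ _ _)) (tri _ _ _ _))
  (tri _ _ _ _)) _.
move: `|ea x| `|eb x| `|ec x| `|ed x| `|ea y| `|eb y| `|ec y| `|ed y| => a b c d a' b' c' d'.
by rewrite !mulnDl !mulnDr; lia.
Qed.

Lemma reduce_modM p x y : reduce_mod p (x * y)%g = (reduce_mod p x * reduce_mod p y)%g.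
Proof.
have entM z : [/\ ea (reduce_mod p z) = (ea z)%:~R%R, eb (reduce_mod p z) = (eb z)%:~R%R,
    ec (reduce_mod p z) = (ec z)%:~R%R & ed (reduce_mod p z) = (ed z)%:~R%R].
  by split; rewrite /ea /eb /ec /ed /= mxE.
have [x1 x2 x3 x4] := entM x; have [y1 y2 y3 y4] := entM y; have [z1 z2 z3 z4] := entM (x * y)%g.
apply: SL2_eq; rewrite ?z1 ?z2 ?z3 ?z4 !entE ?x1 ?x2 ?x3 ?x4 ?y1 ?y2 ?y3 ?y4;
  by rewrite !rmorphD !rmorphM.
Qed.

Lemma reduce_mod1 p : reduce_mod p 1%g = 1%g.
Proof. by apply: (mulgI (reduce_mod p 1%g)); rewrite -reduce_modM !mulg1. Qed.

Lemma reduce_modX p x n : reduce_mod p (x ^+ n)%g = (reduce_mod p x ^+ n)%g.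
Proof. by elim: n => [|n IHn]; rewrite ?reduce_mod1 // !expgS reduce_modM IHn. Qed.

Lemma intr_Fp_inj p (u v : int) : prime p -> `|(u - v)%R| < p ->
  (u%:~R = v%:~R :> 'F_p)%R -> u = v.
Proof.
move=> pp lt /eqP; rewrite -subr_eq0 -rmorphB => /eqP e.
have : (`|(u - v)%R|%:R == 0 :> 'F_p)%R.
  move: e; case: (u - v)%R => n e; first exact/eqP.
  have {}e : (- n.+1%:R = 0 :> 'F_p)%R := e.
  by rewrite -oppr_eq0; apply/eqP.
rewrite -(dvdn_pcharf (pchar_Fp pp)).
by case: (posnP `|(u - v)%R|) => [|pos /(dvdn_leq pos)]; lia.
Qed.

(** Corresponding entries differ by at most [2 * B], so if congruent they are equal. *)
Lemma reduce_mod_inj p B x y : prime p -> 2 * B < p -> norm x <= B -> norm y <= B ->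
  reduce_mod p x = reduce_mod p y -> x = y.
Proof.
move=> pp Bp xB yB e.
have lt (u v : int) : `|u| <= B -> `|v| <= B -> `|(u - v)%R| < p by lia.
have bound z : norm z <= B -> [/\ `|ea z| <= B, `|eb z| <= B, `|ec z| <= B & `|ed z| <= B].
  by rewrite /norm => zB; split; lia.
have [x1 x2 x3 x4] := bound x xB; have [y1 y2 y3 y4] := bound y yB.
have := (congr1 (@ea _) e, congr1 (@eb _) e, congr1 (@ec _) e, congr1 (@ed _) e).
rewrite /ea /eb /ec /ed /= !mxE => -[[[e1 e2] e3] e4].
apply: SL2_eq; [apply: (intr_Fp_inj pp _ e1)|apply: (intr_Fp_inj pp _ e2)|
  apply: (intr_Fp_inj pp _ e3)|apply: (intr_Fp_inj pp _ e4)]; exact: lt.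
Qed.

End IntegerMatrices.

(** * Diameter bounds and growth of the reduced semigroup *)

Section Diameter.
Local Open Scope group_scope.

Lemma cayley_ball_expgs (G : finGroupType) (S : {set G}) l :
  (1 |: (S :|: S^-1))%SET ^+ l \subset cayley_ball S l.
Proof.
elim: l => [|l IHl].
  by apply/fintype.subsetP => z z1; apply/finset.bigcupP; exists ord0; rewrite // expg0 in z1 *.
apply/fintype.subsetP => z; rewrite expgS => /mulsgP[y x yS xS ->].
have /finset.bigcupP[k _ Sx] := fintype.subsetP IHl x xS.
case/setU1P: yS => [-> | yS]; apply/finset.bigcupP.
  by exists (widen_ord (leqnSn _) k); rewrite ?mul1g.
by exists (lift ord0 k); rewrite // lift0 expgS mem_mulg.
Qed.

Lemma cayley_diameter_le (G : finGroupType) (S : {set G}) (genS : <<S>> = [set: G]%SET) l :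
  (1 |: (S :|: S^-1))%SET ^+ l = [set: G]%SET -> cayley_diameter genS <= l.
Proof.
move=> full; rewrite /cayley_diameter; case: ex_minnP => d _; apply.
by rewrite finset.eqEsubset finset.subsetT -full cayley_ball_expgs.
Qed.

(** Takes care of the finitely many [p] below the threshold of the growth argument. *)
Lemma cayley_diameter_bounded (A : set (SL2 int)) p0 : exists B, forall p, p < p0 ->
  forall genA : <<reduction_set p A>> = [set: SL2 'F_p]%SET, cayley_diameter genA <= B.
Proof.
elim: p0 => [|p0 [B BP]]; first by exists 0%N.
have [C CP] : exists C, forall genA : <<reduction_set p0 A>> = [set: SL2 'F_p0]%SET,
    cayley_diameter genA <= C.
  case: (<<reduction_set p0 A>> =P [set: SL2 'F_p0]%SET) => [gen|ngen]; last first.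
    by exists 0%N => genA; case: (ngen genA).
  have [l lP] := cayley_ball_exhausts gen.
  by exists l => genA; rewrite /cayley_diameter; case: ex_minnP => d _; apply.
exists (maxn B C) => p; rewrite ltnS leq_eqVlt => /orP[/eqP->|lt] genA.
  by rewrite leq_max CP orbT.
by rewrite leq_max BP.
Qed.

(** A commuting [A] would have an abelian reduction, but [upper 1] and [lower 1] do not commute. *)
Lemma noncommuting_generators (A : set (SL2 int)) p :
  <<reduction_set p A>> = [set: SL2 'F_p]%SET -> ~ (forall a b, A a -> A b -> a * b = b * a).
Proof.
move=> genA comA; have : abelian <<reduction_set p A>>.
  rewrite abelian_gen; apply/fintype.subsetP => x; rewrite inE => /asboolP[a Aa ->].
  apply/centP => y; rewrite inE => /asboolP[b Ab ->].
  by rewrite /commute -!reduce_modM comA.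
rewrite genA => /centsP/(_ (upper 1%R) (finset.in_setT _) (lower 1%R) (finset.in_setT _))/(congr1 (@ea _)).
rewrite /upper /lower !entE => /eqP.
by rewrite !(mul1r, mul0r, addr0, mulr1) -subr_eq0 addrK oner_eq0.
Qed.

Lemma reduce_mod_prod p (I : Type) (r : seq I) (f : I -> SL2 int) :
  reduce_mod p (\prod_(i <- r) f i) = \prod_(i <- r) reduce_mod p (f i).
Proof.
elim: r => [|i r IHr]; first by rewrite !big_nil reduce_mod1.
by rewrite !big_cons reduce_modM IHr.
Qed.

Lemma mem_prod_expgs (G : finGroupType) (S : {set G}) l (I : Type) (r : seq I) (f : I -> G) :
  (forall i, f i \in S ^+ l) -> \prod_(i <- r) f i \in S ^+ (l * size r).
Proof.
move=> fS; elim: r => [|i r IHr]; first by rewrite big_nil muln0 expg0 inE.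
by rewrite big_cons mulnS expgsD_mem.
Qed.

(** The factor 2 is the norm of the identity, the empty product. *)
Lemma norm_prod_le M (I : Type) (r : seq I) (f : I -> SL2 int) : (forall i, norm (f i) <= M) ->
  norm (\prod_(i <- r) f i) <= 2 * M ^ size r.
Proof.
move=> fM; elim: r => [|i r IHr]; first by rewrite big_nil /norm !entE.
by rewrite big_cons (leq_trans (norm_mul _ _)) //= expnS mulnCA leq_mul.
Qed.

(** Distinct words of length [n] have distinct integer values of norm at most [2 * M ^ n], too small
    to collide modulo [p]. *)
Lemma card_reduction_ge (x y : SL2 int) p n (S : {set SL2 'F_p}) l M : prime p ->
    (forall s t : seq bool, size s = size t ->
      \prod_(i <- s) (if i then x else y) = \prod_(i <- t) (if i then x else y) -> s = t) ->
    norm x <= M -> norm y <= M -> 4 * M ^ n < p ->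
    reduce_mod p x \in S ^+ l -> reduce_mod p y \in S ^+ l ->
  2 ^ n <= #|S ^+ (l * n)|.
Proof.
move=> pp free xM yM Mp xS yS.
pose f (t : n.-tuple bool) := reduce_mod p (\prod_(i <- t) (if i then x else y)).
have f_inj : injective f.
  move=> s t /(reduce_mod_inj (B := 2 * M ^ n) pp) e; apply/val_inj/free.
    by rewrite !size_tuple.
  apply: e; first by rewrite mulnA.
    by rewrite -{2}(size_tuple s) norm_prod_le // => -[].
  by rewrite -{2}(size_tuple t) norm_prod_le // => -[].
have <- : #|{: n.-tuple bool}| = (2 ^ n)%N by rewrite card_tuple card_bool.
rewrite -(card_imset _ f_inj); apply: subset_leq_card; apply/fintype.subsetP => _ /imsetP[t _ ->].
by rewrite /f reduce_mod_prod -{2}(size_tuple t) mem_prod_expgs // => -[].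
Qed.

End Diameter.

Theorem corollary6p3 (R : realType) (A : set (SL2 int))
    (freeA : is_free_subgroup (subgroup_generated A)) :
  exists C : R, forall p : nat, prime p ->
    forall genA : <<reduction_set p A>>%g = [set: SL2 'F_p]%SET,
      ((cayley_diameter genA)%:R <= C * ln (p%:R : R))%R.
Proof.
have n4 j : 0 < j -> 2 + j.+1 <= 4 * j by lia.
have [[a [b [Aa Ab ab]]]|comA] :=
    pselect (exists a b, [/\ A a, A b & (a * b)%g <> (b * a)%g]); last first.
  exists 0%R => p _ genA; case: (noncommuting_generators genA) => a b Aa Ab.
  by apply: contrapT => ab; apply: comA; exists a, b.
have [sgH [X freeX]] := freeA.
have sub x : A x -> subgroup_generated A x by move=> Ax B [_]; apply.
have [k free] := free_semigroup sgH freeX (sub a Aa) (sub b Ab) ab.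
set c := (a ^+ k * b * a ^+ k)%g in free.
(* Adding 2 makes [M] a legitimate base of logarithms. *)
pose M := norm (a * c)%g + norm (c * a)%g + 2.
pose L := 1 + (k + 1 + k).
have [K [q0 fill]] := bounded_power_fills (4 * M).
pose p0 := maxn q0 (4 * M).+1.
have [B small] := cayley_diameter_bounded A p0.
have ln2 : (0 < ln (2%:R : R))%R by rewrite ln_gt0 // ltr1n.
exists ((B + L * K)%:R / ln 2%:R)%R => p pp genA.
suff [n np dn] : exists2 n, 2 ^ n <= p & cayley_diameter genA <= (B + L * K) * n.
  apply: (@le_trans _ _ ((B + L * K) * n)%:R%R); first by rewrite ler_nat.
  rewrite natrM -mulrA ler_wpM2l ?ler0n // mulrC ler_pdivlMr // mulr_natl -lnXn ?ltr0n //.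
  by rewrite -natrX ler_ln ?posrE ?ltr0n ?expn_gt0 ?prime_gt0 // ler_nat.
have [lt|] := ltnP p p0.
  by exists 1%N; rewrite ?expn1 ?prime_gt1 // muln1 (leq_trans (small p lt genA)) // leq_addr.
rewrite geq_max => /andP[qp Mp].
have M2 : 1 < M by rewrite /M addn2.
(* The largest [n] with [4 * M ^ n < p]. *)
pose n := trunc_log M (p.-1 %/ 4).
have Mx : M <= p.-1 %/ 4 by rewrite leq_divRL // mulnC -ltnS prednK ?prime_gt0.
have x0 : 0 < p.-1 %/ 4 by apply: leq_trans Mx; apply: ltnW.
have /andP[nlo nhi] := trunc_log_bounds M2 x0; rewrite -/n in nlo nhi.
have n0 : 0 < n by rewrite trunc_log_gt0 M2 (leq_trans _ Mx) // ltn_predL ltnW.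
pose S := reduction_set p A; pose S1 := (1 |: (S :|: S^-1))%g%SET.
have S11 : 1%g \in S1 by rewrite finset.setU11.
have S1V : (S1^-1)%g = S1.
  by apply/finset.setP => g; rewrite !inE invgK -{1}invg1 (inj_eq invg_inj) orbCA orbC orbA.
have SS1 : S \subset S1 := fintype.subset_trans (finset.subsetUl _ _) (finset.subsetUr _ _).
have redS x : A x -> reduce_mod p x \in S1.
  by move=> Ax; apply: (fintype.subsetP SS1); rewrite inE; apply/asboolP; exists x.
have redX x m : A x -> (reduce_mod p x ^+ m)%g \in (S1 ^+ m)%g.
  move=> Ax; elim: m => [|m IHm]; first by rewrite !expg0 inE.
  by rewrite !expgS mem_mulg // redS.
have redc : reduce_mod p c \in (S1 ^+ (k + 1 + k))%g.
  by rewrite /c !reduce_modM !reduce_modX !expgsD_mem ?redX // expg1 redS.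
have redac : reduce_mod p (a * c)%g \in (S1 ^+ L)%g.
  by rewrite reduce_modM expgsD_mem // expg1 redS.
have redca : reduce_mod p (c * a)%g \in (S1 ^+ L)%g.
  by rewrite reduce_modM /L addnC expgsD_mem // expg1 redS.
have p4 : 4 * M ^ n < p.
  rewrite mulnC -(prednK (prime_gt0 pp)) ltnS.
  by apply: leq_trans (leq_trunc_div p.-1 4); rewrite leq_mul2r nlo orbT.
have big : 2 ^ n <= #|(S1 ^+ (L * n))%g|.
  have acM : norm (a * c)%g <= M by rewrite /M -addnA leq_addr.
  have caM : norm (c * a)%g <= M by rewrite /M addnAC leq_addl.
  exact: card_reduction_ge pp free acM caM p4 redac redca.
set T := (S1 ^+ (L * n))%g in big.
have T1 : 1%g \in T by apply: expgs1.
have TV : (T^-1)%g = T.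
  apply/finset.setP => g; rewrite inE; apply/idP/idP => gT; last exact: expgsV_mem.
  by rewrite -[g]invgK expgsV_mem.
have genT : <<T>>%g = [set: SL2 'F_p]%SET.
  apply/eqP; rewrite finset.eqEsubset finset.subsetT -genA genS //.
  by rewrite (fintype.subset_trans SS1) // -{1}[S1]expg1 expgs_sub // muln_gt0 n0.
have pF : #|{: 'F_p}| = p by apply: card_Fp.
(* The chain is [p <= 4 * M ^ n.+1 <= M ^ (n + 3) <= M ^ (4 * n) <= 2 ^ (4 * M * n)], which explains
   the exponent [4 * M]. *)
have pT : #|'F_p| <= #|T| ^ (4 * M).
  rewrite pF; apply: (@leq_trans (M ^ (4 * n))).
    apply: (@leq_trans (4 * M ^ n.+1)).
      by rewrite -(prednK (prime_gt0 pp)) mulnC -ltn_divLR.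
    apply: (@leq_trans (M ^ 2 * M ^ n.+1)).
      by rewrite leq_mul2r (leq_exp2r 2 M (isT : 0 < 2)) M2 orbT.
    by rewrite -expnD leq_pexp2l ?(ltnW M2) ?n4.
  apply: (@leq_trans ((2 ^ n) ^ (4 * M))); last by rewrite leq_exp2r // muln_gt0 (ltnW M2).
  have -> : (2 ^ n) ^ (4 * M) = (2 ^ M) ^ (4 * n).
    by rewrite -!expnM mulnA mulnC [n * 4]mulnC.
  rewrite leq_exp2r ?muln_gt0 ?n0 //.
  exact: ltnW (ltn_expl M (isT : 1 < 2)).
have p3 : 3 < p.
  by apply: leq_trans Mp; rewrite ltnS (@leq_trans (4 * 1)) // leq_mul2l (ltnW M2).
have nz d : 0 < d <= 3 -> (d%:R != 0 :> 'F_p)%R.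
  move=> /andP[d0 d3]; rewrite -(dvdn_pcharf (pchar_Fp pp)); apply/negP => /(dvdn_leq d0).
  by rewrite leqNgt (leq_ltn_trans d3 p3).
have full := fill 'F_p T (nz 2 isT) (nz 3 isT) (_ : q0 <= _) T1 TV genT pT.
exists n.
  apply/ltnW/(leq_ltn_trans _ p4)/(leq_trans _ (leq_pmull _ (isT : 0 < 4))).
  by rewrite leq_exp2r.
apply: leq_trans (cayley_diameter_le genA (l := L * n * K) _) _.
  by rewrite expgM full // pF.
by rewrite mulnAC leq_mul2r leq_addl orbT.
Qed.
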